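(* Let $N\ge3$, $p>p_S$, and let $S>0$. For any sequence $\gamma_j\to\infty$, setting $u_j:=u(\cdot,\gamma_j)$, we have, as $j\to\infty$, $u_j\to u^*$, $u_j'\to(u^* )'$ and $u_j''\to(u^* )''$ uniformly on every compact subset of $(0,S]$.
   Context: $f(u):=-u+u^p$, $p_S:=\frac{N+2}{N-2}$, $\theta:=\frac{2}{p-1}$, $A:=\{\theta(N-2-\theta)\}^{1/(p-1)}$, $m:=\{\theta(N-2-\theta)\}^{-1/2}$, $\alpha:=m(N-2-2\theta)$. $u(s,\gamma)$ denotes the solution of $u''+\frac{N-1}{s}u'+f(u)=0$, $u(0)=\gamma$, $u'(0)=0$. $y^*$ is the unique solution on $\mathbb{R}$ of $y''+\alpha y'-y+y^p-m^2e^{2mt}y=0$ with $y(t)\to1$ as $t\to-\infty$, and $u^*(s):=As^{-\theta}y^*(m^{-1}\log s)$, $s>0$. (In the paper $S$ is taken to be the $(n+1)$-st positive critical point of $u^*$ for a fixed $n$.) *)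

(* Defs.v *)
From Stdlib Require Import Reals Lra.
Open Scope R_scope.

(* u^p for u > 0 (real exponent); the paper works with positive solutions. *)
Definition rpow (u p : R) : R := Rpower u p.

Definition fnl (p u : R) : R := - u + rpow u p.

Definition pS (N : nat) : R := (INR N + 2) / (INR N - 2).
Definition theta (p : R) : R := 2 / (p - 1).
Definition Aconst (N : nat) (p : R) : R :=
  Rpower (theta p * (INR N - 2 - theta p)) (1 / (p - 1)).
Definition mconst (N : nat) (p : R) : R :=
  / sqrt (theta p * (INR N - 2 - theta p)).
Definition alpha (N : nat) (p : R) : R :=
  mconst N p * (INR N - 2 - 2 * theta p).

Definition rad_sol (N : nat) (p gamma T : R) (v v1 v2 : R -> R) : Prop :=
  v 0 = gamma /\ v1 0 = 0 /\
  forall s, 0 <= s <= T ->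
    derivable_pt_lim v s (v1 s) /\
    derivable_pt_lim v1 s (v2 s) /\
    0 < v s /\
    (0 < s -> v2 s + (INR N - 1) / s * v1 s + fnl p (v s) = 0).

Definition ystar_sol (N : nat) (p : R) (y y1 y2 : R -> R) : Prop :=
  (forall t, derivable_pt_lim y t (y1 t) /\ derivable_pt_lim y1 t (y2 t) /\
     0 < y t /\
     y2 t + alpha N p * y1 t - y t + rpow (y t) p
       - (mconst N p)^2 * exp (2 * mconst N p * t) * y t = 0) /\
  (forall eps, 0 < eps -> exists T, forall t, t < T -> Rabs (y t - 1) < eps).

Definition ustar (N : nat) (p : R) (y : R -> R) (s : R) : R :=
  Aconst N p * Rpower s (- theta p) * y (ln s / mconst N p).

(* Main.v *)
Require Import Defs.
From Stdlib Require Import Reals Lra Lia Psatz.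
From Coquelicot Require Import Coquelicot.
Open Scope R_scope.

(** In the Emden-Fowler variables [u(s) = A s^-theta y(t)], [s = e^(m t)], the
    equation becomes [y'' + alpha y' - y + y^p - m^2 e^(2mt) y = 0], whose energy
    is nonincreasing because [alpha > 0] (that is, [p > pS]). A regular solution
    has energy tending to [0] at [-oo], so its energy is negative; this bounds it
    from above uniformly in [gamma] and, with a quantitative energy drop inside
    the core [s = O(gamma^(-(p-1)/2))], keeps it away from zero (Pohozaev).
    The core recedes to [t = -oo] as [gamma -> oo]. On the long time interval left
    behind, boundedness of a perturbed energy forces a time at which [y'] and
    [y - y^p] are small; since the energy is bounded away from [0], [y] is near
    [1] there, and so is [y^*]. The decreasing energy then traps [y] near the
    minimum [1] of the potential; the difference [y - y^*] solves a damped
    oscillator with a small perturbation and stays small up to a fixed time, from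
    which Gronwall's inequality carries it to the end point. *)

(** * Energy of the Emden-Fowler equation *)

(** The obstacle is uniformity. The time at which the core ends moves with [gamma], so every
    constant up to the comparison with [y^*] may depend only on a bound [M], an energy gap [eta] and
    the end time. The gap is free of [gamma] by scaling: at radii of order [gamma^(-(p-1)/2)] the
    factor [s^theta] is of order [1/gamma], because [theta (p-1) = 2], and cancels the size [gamma]
    of [u]. The quiet time is not under control either, so the estimate from it up to a fixed time
    must not depend on the length of that interval; the damping supplies this, whereas the constant
    of Gronwall's inequality grows with the length. Existence of a positive solution up to [S] is
    part of the conclusion and rests on the same lower bound: the nonlinearity is clamped to become
    globally Lipschitz, the clamped problem is solved for all radii, and the a priori bounds show
    that the clamp never acts on [[0, S]]. *)

Lemma deriv_nonpos_le (F F' : R -> R) (a b : R) :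
  a <= b ->
  (forall t, a <= t <= b -> derivable_pt_lim F t (F' t)) ->
  (forall t, a < t < b -> F' t <= 0) -> F b <= F a.
Proof.
intros [Hab | ->] HF Hle; [|lra].
destruct (MVT_cor2 F F' a b Hab HF) as (c & Hc & Hc').
specialize (Hle c Hc'). nra.
Qed.

Ltac rewrite_derives :=
  repeat match goal with
  | D : is_derive ?f ?t ?l |- context [Derive ?g ?t] =>
      replace (Derive g t) with l by (symmetry; apply is_derive_unique; exact D)
  end.

Lemma Rpower_pos (x y : R) : 0 < Rpower x y.
Proof. apply exp_pos. Qed.

Lemma exp_le_mono (x y : R) : x <= y -> exp x <= exp y.
Proof. intros [H | ->]; [left; now apply exp_increasing | apply Rle_refl]. Qed.

Lemma Rpower_split (x y : R) : 0 < x -> Rpower x y = x * Rpower x (y - 1).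
Proof.
intros Hx. rewrite <- (Rpower_1 x Hx) at 2. rewrite <- Rpower_plus.
f_equal; lra.
Qed.

Lemma Rpower_gt_1 (x q : R) : 0 < q -> 1 < x -> 1 < Rpower x q.
Proof.
intros Hq Hx. rewrite <- (Rpower_O x) by lra. now apply Rpower_lt.
Qed.

Lemma Rpower_1_l (q : R) : Rpower 1 q = 1.
Proof. unfold Rpower. now rewrite ln_1, Rmult_0_r, exp_0. Qed.

Lemma Rpower_lt_1 (x q : R) : 0 < q -> 0 < x < 1 -> Rpower x q < 1.
Proof.
intros Hq Hx. rewrite <- (Rpower_1_l q). now apply Rlt_Rpower_l.
Qed.

(** The half line [t <= T] is the common domain: transforms of solutions on [[0, S]] stop at
    [ln S / m], and [y^*] is restricted to it. *)
Definition emden_sol (m al p T : R) (Y Y1 Y2 : R -> R) : Prop :=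
  forall t, t <= T ->
    derivable_pt_lim Y t (Y1 t) /\ derivable_pt_lim Y1 t (Y2 t) /\
    0 < Y t /\
    Y2 t + al * Y1 t - Y t + Rpower (Y t) p
      - m ^ 2 * exp (2 * m * t) * Y t = 0.

(** Potential of the autonomous part: its derivative is [y^p - y], so its minimum over [y > 0] is at
    [1], and it tends to [0] with [y]. *)
Definition well (p y : R) : R := - y ^ 2 / 2 + y * Rpower y p / (p + 1).

Definition energy (m p : R) (Y Y1 : R -> R) (t : R) : R :=
  (Y1 t) ^ 2 / 2 + well p (Y t) - m ^ 2 * exp (2 * m * t) * (Y t) ^ 2 / 2.

(** The equation cancels all mixed terms; what is left is the friction and the explicit time
    derivative of the forcing coefficient. *)
Lemma energy_deriv (m al p T : R) (Y Y1 Y2 : R -> R) (t : R) :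
  1 < p -> emden_sol m al p T Y Y1 Y2 -> t <= T ->
  derivable_pt_lim (energy m p Y Y1) t
    (- al * Y1 t ^ 2 - m * (m ^ 2 * exp (2 * m * t)) * Y t ^ 2).
Proof.
intros Hp H Ht. destruct (H t Ht) as (D1 & D2 & Hpos & E).
apply is_derive_Reals in D1, D2. apply is_derive_Reals.
unfold energy, well, Rpower. auto_derive.
- repeat split; try lra; eexists; eassumption.
- rewrite_derives.
  unfold Rpower in E.
  replace (Y2 t) with (- al * Y1 t + Y t - exp (p * ln (Y t))
      + m ^ 2 * exp (2 * m * t) * Y t) by lra.
  field. lra.
Qed.

Lemma energy_decr (m al p T : R) (Y Y1 Y2 : R -> R) (a b : R) :
  0 < m -> 0 < al -> 1 < p -> emden_sol m al p T Y Y1 Y2 -> a <= b <= T ->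
  energy m p Y Y1 b <= energy m p Y Y1 a.
Proof.
intros Hm Hal Hp H Hab.
eapply deriv_nonpos_le; [lra| |].
- intros t Ht. apply (energy_deriv m al p T Y Y1 Y2 t Hp H); lra.
- intros t Ht. cbv beta. assert (0 < exp (2 * m * t)) by apply exp_pos.
  assert (0 <= Y1 t ^ 2) by apply pow2_ge_0. assert (0 <= Y t ^ 2) by apply pow2_ge_0.
  assert (0 <= m * (m ^ 2 * exp (2 * m * t))) by
    (apply Rmult_le_pos; [lra | apply Rmult_le_pos; nra]).
  nra.
Qed.

(** With [H = m^2 e^(2mT)] and [K = (p+1)/2 (1+H)], negative energy yields [Y <= K^(1/(p-1))] and
    [|Y'| <= (1+H) K^(1/(p-1))]; this single crude constant dominates both. *)
Definition emden_bound (m p T : R) : R :=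
  1 + m ^ 2 * exp (2 * m * T)
  + (1 + (p + 1) / 2 * (1 + m ^ 2 * exp (2 * m * T))
     + Rpower ((p + 1) / 2 * (1 + m ^ 2 * exp (2 * m * T))) (1 / (p - 1)))
    * (1 + m ^ 2 * exp (2 * m * T)).

Lemma Rpower_Rpower_inv (x q : R) : 0 < x -> 0 < q -> Rpower (Rpower x q) (1 / q) = x.
Proof.
intros Hx Hq. rewrite Rpower_mult.
replace (q * (1 / q)) with 1 by (field; lra). now apply Rpower_1.
Qed.

Lemma forcing_le (m t T : R) : 0 < m -> t <= T ->
  0 < m ^ 2 * exp (2 * m * t) <= m ^ 2 * exp (2 * m * T).
Proof.
intros Hm Ht. assert (0 < m ^ 2) by nra. split.
- apply Rmult_lt_0_compat; [lra | apply exp_pos].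
- apply Rmult_le_compat_l; [lra|].
  apply exp_le_mono. nra.
Qed.

(** Nonpositive energy reads [Y'^2/2 + Y^(p+1)/(p+1) <= (1+h) Y^2/2]. Dropping [Y'^2] and dividing
    by [Y^2 > 0] bounds [Y^(p-1)]; putting this back bounds [Y']. *)
Lemma energy_nonpos_bounds (m p T t : R) (Y Y1 : R -> R) :
  0 < m -> 1 < p -> t <= T -> 0 < Y t -> energy m p Y Y1 t <= 0 ->
  Y t <= emden_bound m p T /\ Rabs (Y1 t) <= emden_bound m p T.
Proof.
intros Hm Hp Ht Hpos HE.
destruct (forcing_le m t T Hm Ht) as [Hh0 Hh].
unfold energy, well in HE. unfold emden_bound.
set (h := m ^ 2 * exp (2 * m * t)) in *.
set (H := m ^ 2 * exp (2 * m * T)) in *.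
set (K := (p + 1) / 2 * (1 + H)) in *.
assert (HK : 0 < K) by (unfold K; nra).
set (M := Rpower K (1 / (p - 1))).
assert (HM : 0 < M) by apply Rpower_pos.
rewrite (Rpower_split (Y t) p Hpos) in HE.
set (P := Rpower (Y t) (p - 1)) in *.
assert (HP : 0 < P) by apply Rpower_pos.
assert (HE2 : Y1 t ^ 2 / 2 + Y t ^ 2 * (P / (p + 1)) <= (1 + H) / 2 * Y t ^ 2).
{ assert (h * Y t ^ 2 <= H * Y t ^ 2) by (apply Rmult_le_compat_r; [apply pow2_ge_0 | lra]).
  replace (Y t * (Y t * P) / (p + 1)) with (Y t ^ 2 * (P / (p + 1))) in HE
    by (field; lra). lra. }
assert (HY2 : 0 < Y t ^ 2) by nra.
assert (HPle : P <= K).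
{ assert (P / (p + 1) <= (1 + H) / 2) by (apply Rmult_le_reg_l with (Y t ^ 2); nra).
  unfold K. apply Rmult_le_reg_r with (/ (p + 1)).
  - apply Rinv_0_lt_compat; lra.
  - replace ((p + 1) / 2 * (1 + H) * / (p + 1)) with ((1 + H) / 2) by (field; lra).
    assumption. }
assert (HYM : Y t <= M).
{ unfold M. rewrite <- (Rpower_Rpower_inv (Y t) (p - 1)) by lra.
  apply Rle_Rpower_l; [|fold P; lra].
  apply Rlt_le, Rdiv_lt_0_compat; lra. }
assert (0 < P / (p + 1)) by (apply Rdiv_lt_0_compat; lra).
split.
- nra.
- apply Rabs_le.
  assert (Y1 t ^ 2 <= (1 + H) * M ^ 2).
  { assert (Y t ^ 2 <= M ^ 2) by nra. nra. }
  assert (Hs : Y1 t ^ 2 <= ((1 + H) * M) ^ 2) by nra.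
  assert (0 <= (1 + H) * M) by nra.
  assert (Rabs (Y1 t) <= (1 + H) * M).
  { apply Rsqr_incr_0_var; [|assumption]. rewrite <- Rsqr_abs. unfold Rsqr. lra. }
  assert (- ((1 + H) * M) <= Y1 t <= (1 + H) * M) by (apply Rabs_le_between; assumption).
  assert (0 <= K * (1 + H)) by nra.
  nra.
Qed.

Lemma forcing_small (m T0 eps : R) : 0 < m -> 0 < eps ->
  exists T1, T1 <= T0 /\ forall t, t <= T1 -> 0 < m ^ 2 * exp (2 * m * t) <= eps.
Proof.
intros Hm He. assert (Hm2 : 0 < m ^ 2) by nra.
exists (Rmin T0 (ln (eps / m ^ 2) / (2 * m))). split; [apply Rmin_l|].
intros t Ht. destruct (forcing_le m t _ Hm Ht) as [H0 H1]. split; [assumption|].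
eapply Rle_trans; [apply H1|].
eapply Rle_trans; [apply (forcing_le m _ _ Hm (Rmin_r _ _))|].
replace (2 * m * (ln (eps / m ^ 2) / (2 * m))) with (ln (eps / m ^ 2)) by (field; lra).
rewrite exp_ln by (apply Rdiv_lt_0_compat; lra). right; field; lra.
Qed.

(** The defect [y - y^p] vanishes also as [y] tends to [0]; the floor [eta <= y^2] excludes that
    second rest point. In the factorisation [y (1 - y^(p-1))] the factor [y] is at least [1] on the
    upper side and is controlled by [eta] on the lower side. *)
Lemma well_defect_near (p eta del : R) :
  1 < p -> 0 < eta -> 0 < del ->
  exists kap, 0 < kap /\ forall y, 0 < y -> eta <= y ^ 2 ->
    (y - Rpower y p) ^ 2 < kap -> Rabs (y - 1) < del.
Proof.
intros Hp Heta Hdel. set (d := Rmin del (1 / 2)).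
assert (Hd : 0 < d <= 1 / 2) by (unfold d; split; [apply Rmin_glb_lt; lra | apply Rmin_r]).
assert (Hdd : d <= del) by apply Rmin_l.
set (k1 := Rpower (1 + d) (p - 1) - 1). set (k2 := 1 - Rpower (1 - d) (p - 1)).
assert (Hk1 : 0 < k1) by (assert (H := Rpower_gt_1 (1 + d) (p - 1) ltac:(lra) ltac:(lra)); unfold k1; lra).
assert (Hk2 : 0 < k2) by (assert (H := Rpower_lt_1 (1 - d) (p - 1) ltac:(lra) ltac:(lra)); unfold k2; lra).
exists (Rmin (k1 ^ 2) (eta * k2 ^ 2)). split; [apply Rmin_glb_lt; [nra | apply Rmult_lt_0_compat; nra]|].
intros y Hy Hye H.
assert (Ha := Rlt_le_trans _ _ _ H (Rmin_l _ _)).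
assert (Hb := Rlt_le_trans _ _ _ H (Rmin_r _ _)). clear H.
rewrite (Rpower_split y p Hy) in Ha, Hb.
replace (y - y * Rpower y (p - 1)) with (y * (1 - Rpower y (p - 1))) in Ha, Hb by ring.
apply Rlt_le_trans with d; [|assumption].
apply Rabs_def1; apply Rnot_le_lt; intros Hc.
- assert (Rpower (1 + d) (p - 1) <= Rpower y (p - 1)) by (apply Rle_Rpower_l; lra).
  assert (k1 <= Rpower y (p - 1) - 1) by (unfold k1; lra).
  assert (k1 <= y * (Rpower y (p - 1) - 1)) by nra.
  nra.
- assert (Rpower y (p - 1) <= Rpower (1 - d) (p - 1)) by (apply Rle_Rpower_l; lra).
  assert (k2 <= 1 - Rpower y (p - 1)) by (unfold k2; lra).
  assert (k2 ^ 2 <= (1 - Rpower y (p - 1)) ^ 2) by nra.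
  assert (eta * k2 ^ 2 <= y ^ 2 * (1 - Rpower y (p - 1)) ^ 2)
    by (apply Rmult_le_compat; nra).
  rewrite Rpow_mult_distr in Hb. lra.
Qed.

(* [b] is small enough for subtracting [b y' (y - y^p)] from the energy to make
   the result dissipate both [y'^2] and [(y - y^p)^2], up to the forcing. *)
Lemma quiet_time (m al p M T0 eta del : R) :
  0 < m -> 0 < al -> 1 < p -> 0 < M -> 0 < eta -> 0 < del ->
  exists T1 tau0, tau0 < T1 <= T0 /\
  forall Y Y1 Y2, emden_sol m al p T1 Y Y1 Y2 ->
  forall tau, tau <= tau0 ->
  (forall t, tau <= t <= T1 ->
     Y t <= M /\ Rabs (Y1 t) <= M /\ energy m p Y Y1 t <= - eta) ->
  exists t1, tau < t1 < T1 /\ Rabs (Y t1 - 1) < del /\ Rabs (Y1 t1) < del.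
Proof.
intros Hm Hal Hp HM Heta Hdel.
destruct (well_defect_near p eta del Hp Heta Hdel) as (kap & Hkap & Hnear).
set (Phi := M + Rpower M p). set (Q := Rpower M (p - 1)).
assert (HQ : 0 < Q) by apply Rpower_pos.
assert (HPhi : 0 < Phi) by (assert (H := Rpower_pos M p); unfold Phi; lra).
set (b := al / (al ^ 2 + 2 * p * Q)).
assert (HpQ : 0 < p * Q) by (apply Rmult_lt_0_compat; lra).
assert (Hb : 0 < b) by (apply Rdiv_lt_0_compat; nra).
(* Besides half of [b (y - y^p)^2], the cross terms in the derivative of the perturbation cost at
   most [b (al^2/2 + p Q) y'^2], which is half of the friction. *)
assert (Hb2 : b * (al ^ 2 / 2 + p * Q) = al / 2) by (unfold b; field; nra).
clearbody b.
set (mu := Rmin (al / 2 * del ^ 2) (b / 2 * kap)).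
assert (Hmu : 0 < mu) by (apply Rmin_glb_lt; apply Rmult_lt_0_compat; nra).
assert (Hmu1 : mu <= al / 2 * del ^ 2) by apply Rmin_l.
assert (Hmu2 : mu <= b / 2 * kap) by apply Rmin_r.
set (B := b * (M * Phi)).
assert (HMP : 0 < M * Phi) by now apply Rmult_lt_0_compat.
assert (HB : 0 < B) by now apply Rmult_lt_0_compat.
(* Forcing at most [1] gives the energy floor [-M^2]; forcing at most [mu / (2 B)] limits its share
   of the perturbation's derivative to [mu / 2]. *)
destruct (forcing_small m T0 (Rmin 1 (mu / (2 * B))) Hm) as (T1 & HT1 & Hforce).
{ apply Rmin_glb_lt; [lra | apply Rdiv_lt_0_compat; lra]. }
set (C := M ^ 2 + 2 * B).
assert (HC : 0 < C) by (unfold C; nra).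
(* The perturbed energy falls by at most [C]: [M^2] from the energy, [B] from the perturbation at
   each end. Over a length above [2 C / mu] its derivative must exceed [- mu / 2] somewhere, and
   that point is the quiet time. *)
exists T1, (T1 - 2 * C / mu - 1). split.
{ assert (0 < 2 * C / mu) by (apply Rdiv_lt_0_compat; lra). lra. }
intros Y Y1 Y2 HY tau Htau Hbd.
assert (HL : 2 * C / mu < T1 - tau) by lra.
assert (HL0 : 0 < 2 * C / mu) by (apply Rdiv_lt_0_compat; lra).
assert (Hphi : forall t, tau <= t <= T1 -> 0 < Y t <= M /\ Rabs (Y t - Rpower (Y t) p) <= Phi
    /\ Rabs (Y1 t * (Y t - Rpower (Y t) p)) <= M * Phi).
{ intros t Ht. destruct (HY t ltac:(lra)) as (_ & _ & Hpos & _).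
  destruct (Hbd t Ht) as (Hy & Hy1 & _).
  assert (HR : Rpower (Y t) p <= Rpower M p) by (apply Rle_Rpower_l; lra).
  assert (HR0 := Rpower_pos (Y t) p).
  assert (Rabs (Y t - Rpower (Y t) p) <= Phi) by (apply Rabs_le; unfold Phi; lra).
  repeat split; try lra. rewrite Rabs_mult.
  apply Rmult_le_compat; auto using Rabs_pos. }
set (W := fun t => energy m p Y Y1 t - b * (Y1 t * (Y t - Rpower (Y t) p))).
set (W' := fun t => (- al * Y1 t ^ 2 - m * (m ^ 2 * exp (2 * m * t)) * Y t ^ 2)
   - b * (Y2 t * (Y t - Rpower (Y t) p)
          + Y1 t * (Y1 t - p * Rpower (Y t) (p - 1) * Y1 t))).
destruct (MVT_cor2 W W' tau T1) as (xi & Hxi & Hxi'); [lra| |].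
{ intros t Ht. apply is_derive_Reals. unfold W, W'.
  destruct (HY t ltac:(lra)) as (D1 & D2 & Hpos & _).
  apply @is_derive_minus with (V := R_NormedModule).
  - apply is_derive_Reals. apply (energy_deriv m al p T1 Y Y1 Y2 t Hp HY); lra.
  - apply is_derive_Reals in D1, D2. unfold Rpower. auto_derive.
    + repeat split; try lra; eexists; eassumption.
    + rewrite_derives.
      replace (exp (p * ln (Y t))) with (Y t * exp ((p - 1) * ln (Y t)))
        by (symmetry; apply (Rpower_split (Y t) p Hpos)).
      field. lra. }
exists xi. split; [lra|].
assert (Hdrop : - C <= W T1 - W tau).
{ unfold W. destruct (Hphi T1 ltac:(lra)) as (Hy & _ & Ha).
  destruct (Hphi tau ltac:(lra)) as (_ & _ & Hb').
  apply Rabs_le_between in Ha, Hb'.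
  destruct (Hbd tau ltac:(lra)) as (_ & _ & Etau).
  assert (- M ^ 2 <= energy m p Y Y1 T1).
  { unfold energy, well. destruct (Hforce T1 ltac:(lra)) as [h0 h1].
    assert (h2 := Rle_trans _ _ _ h1 (Rmin_l _ _)).
    set (h := m ^ 2 * exp (2 * m * T1)) in *.
    assert (0 < Y T1 * Rpower (Y T1) p / (p + 1)).
    { apply Rdiv_lt_0_compat; [|lra]. apply Rmult_lt_0_compat; [lra|apply Rpower_pos]. }
    assert (Y T1 ^ 2 <= M ^ 2) by nra. assert (0 <= Y1 T1 ^ 2) by apply pow2_ge_0.
    assert (h * Y T1 ^ 2 <= 1 * Y T1 ^ 2) by (apply Rmult_le_compat_r; [apply pow2_ge_0 | lra]).
    lra. }
  assert (b * (Y1 T1 * (Y T1 - Rpower (Y T1) p)) <= B)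
    by (unfold B; apply Rmult_le_compat_l; lra).
  assert (- B <= b * (Y1 tau * (Y tau - Rpower (Y tau) p))).
  { unfold B. rewrite Ropp_mult_distr_r. apply Rmult_le_compat_l; lra. }
  unfold C. lra. }
assert (HWx : - mu / 2 < W' xi).
{ rewrite Hxi in Hdrop. apply Rnot_le_lt. intros Hc.
  assert (W' xi * (T1 - tau) < - C); [|lra].
  apply Rle_lt_trans with (- mu / 2 * (T1 - tau)).
  - apply Rmult_le_compat_r; lra.
  - replace (- C) with (- mu / 2 * (2 * C / mu)) by (field; lra).
    apply Rmult_lt_gt_compat_neg_l; lra. }
destruct (Hphi xi ltac:(lra)) as (Hy & Hp1 & Hp2).
destruct (HY xi ltac:(lra)) as (_ & _ & _ & Eq).
destruct (Hbd xi ltac:(lra)) as (_ & _ & Exi).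
destruct (Hforce xi ltac:(lra)) as [h0 h1].
assert (h2 := Rle_trans _ _ _ h1 (Rmin_l _ _)).
assert (h3 := Rle_trans _ _ _ h1 (Rmin_r _ _)).
unfold W' in HWx.
set (h := m ^ 2 * exp (2 * m * xi)) in *.
set (phi := Y xi - Rpower (Y xi) p) in *.
replace (Y2 xi) with (- al * Y1 xi + phi + h * Y xi) in HWx by (unfold phi; lra).
assert (HR : Rpower (Y xi) (p - 1) <= Q) by (apply Rle_Rpower_l; lra).
assert (HR0 := Rpower_pos (Y xi) (p - 1)).
set (r := Rpower (Y xi) (p - 1)) in *.
assert (Hsum : al / 2 * Y1 xi ^ 2 + b / 2 * phi ^ 2 < mu).
{ assert (Hhphi : - (b * (h * Y xi * phi)) <= mu / 2).
  { apply Rabs_le_between in Hp1.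
    assert (- (Y xi * phi) <= M * Phi) by nra.
    replace (- (b * (h * Y xi * phi))) with (h * (b * - (Y xi * phi))) by ring.
    apply Rle_trans with (h * B).
    - apply Rmult_le_compat_l; [lra|]. unfold B. apply Rmult_le_compat_l; lra.
    - replace (mu / 2) with (mu / (2 * B) * B) by (field; lra).
      apply Rmult_le_compat_r; lra. }
  assert (0 <= m * h * Y xi ^ 2) by (apply Rmult_le_pos; [nra | apply pow2_ge_0]).
  assert (b * (al * Y1 xi * phi) <= b * (phi ^ 2 / 2 + al ^ 2 * Y1 xi ^ 2 / 2)).
  { apply Rmult_le_compat_l; [lra|]. assert (0 <= (al * Y1 xi - phi) ^ 2) by apply pow2_ge_0. lra. }
  assert (b * (p * r * Y1 xi ^ 2) <= b * (p * Q * Y1 xi ^ 2)).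
  { apply Rmult_le_compat_l; [lra|]. apply Rmult_le_compat_r; nra. }
  assert (b * (al ^ 2 * Y1 xi ^ 2 / 2) + b * (p * Q * Y1 xi ^ 2) = al / 2 * Y1 xi ^ 2)
    by (rewrite <- Hb2; field).
  assert (0 <= b * Y1 xi ^ 2) by (apply Rmult_le_pos; [lra | apply pow2_ge_0]).
  lra. }
assert (0 <= al / 2 * Y1 xi ^ 2) by (apply Rmult_le_pos; [lra | apply pow2_ge_0]).
assert (0 <= b / 2 * phi ^ 2) by (apply Rmult_le_pos; [lra | apply pow2_ge_0]).
split.
(* Since the forcing is at most [1], an energy below [- eta] forces [Y^2 >= eta]. *)
- apply Hnear; [lra| |fold phi].
  + unfold energy, well in Exi. fold h in Exi.
    assert (0 < Y xi * Rpower (Y xi) p / (p + 1)).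
    { apply Rdiv_lt_0_compat; [|lra]. apply Rmult_lt_0_compat; [lra|apply Rpower_pos]. }
    assert (h * Y xi ^ 2 <= 1 * Y xi ^ 2) by (apply Rmult_le_compat_r; [apply pow2_ge_0 | lra]).
    assert (0 <= Y1 xi ^ 2) by apply pow2_ge_0. lra.
  + apply Rmult_lt_reg_l with (b / 2); lra.
- assert (Y1 xi ^ 2 < del ^ 2) by (apply Rmult_lt_reg_l with (al / 2); lra).
  apply Rnot_le_lt. intros Hc.
  assert (Hc2 : del ^ 2 <= Rabs (Y1 xi) ^ 2) by (apply pow_incr; lra). rewrite pow2_abs in Hc2. lra.
Qed.

(** * Potential well, damped oscillator and Gronwall estimates *)

Lemma well_deriv (p y : R) : 1 < p -> 0 < y ->
  derivable_pt_lim (well p) y (Rpower y p - y).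
Proof.
intros Hp Hy. apply is_derive_Reals. unfold well, Rpower. auto_derive; [lra|].
field. lra.
Qed.

Lemma well_incr (p a b : R) : 1 < p -> 1 <= a < b -> well p a < well p b.
Proof.
intros Hp Hab.
destruct (MVT_cor2 (well p) (fun y => Rpower y p - y) a b) as (c & Hc & Hc'); [lra| |].
- intros c Hc. apply well_deriv; lra.
- rewrite (Rpower_split c p) in Hc by lra.
  assert (H := Rpower_gt_1 c (p - 1) ltac:(lra) ltac:(lra)).
  assert (0 < (c * Rpower c (p - 1) - c) * (b - a)) by (apply Rmult_lt_0_compat; nra).
  lra.
Qed.

(** The potential decreases on [(0, 1]] and increases on [[1, oo)], so [g] can be the lower of the
    two barriers at [1 - rho] and [1 + rho]. *)
Lemma well_min (p rho : R) : 1 < p -> 0 < rho < 1 ->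
  exists g, 0 < g /\
  forall y, 0 < y -> well p y < well p 1 + g -> Rabs (y - 1) < rho.
Proof.
intros Hp Hrho.
assert (Hdec : forall a b, 0 < a < b -> b <= 1 -> well p b < well p a).
{ intros a b Hab Hb.
  destruct (MVT_cor2 (well p) (fun y => Rpower y p - y) a b) as (c & Hc & Hc'); [lra| |].
  - intros c Hc. apply well_deriv; lra.
  - rewrite (Rpower_split c p) in Hc by lra.
    assert (H := Rpower_lt_1 c (p - 1) ltac:(lra) ltac:(lra)).
    assert (0 < (c - c * Rpower c (p - 1)) * (b - a)) by (apply Rmult_lt_0_compat; nra).
    lra. }
exists (Rmin (well p (1 + rho)) (well p (1 - rho)) - well p 1). split.
- apply Rlt_0_minus. apply Rmin_glb_lt; [apply well_incr | apply Hdec]; lra.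
- intros y Hy H.
  assert (Ha : well p y < well p (1 + rho))
    by (eapply Rlt_le_trans; [apply H|]; ring_simplify; apply Rmin_l).
  assert (Hb : well p y < well p (1 - rho))
    by (eapply Rlt_le_trans; [apply H|]; ring_simplify; apply Rmin_r).
  apply Rabs_def1; apply Rnot_le_lt; intros [Hc | Hc].
  + assert (Hinc := well_incr p (1 + rho) y Hp). lra.
  + replace y with (1 + rho) in Ha by lra. lra.
  + specialize (Hdec y (1 - rho)). lra.
  + replace y with (1 - rho) in Hb by lra. lra.
Qed.

Lemma continuity_pt_eps (f : R -> R) (x eps : R) :
  continuity_pt f x -> 0 < eps ->
  exists d, 0 < d /\ forall z, Rabs (z - x) < d -> Rabs (f z - f x) < eps.
Proof.
intros Hc He. destruct (Hc eps He) as (d & Hd & Hc'). exists d. split; [exact Hd|].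
intros z Hz. destruct (Req_dec z x) as [->|Hne].
- rewrite Rminus_diag, Rabs_R0. exact He.
- apply (Hc' z). split; [split; [exact I | congruence] | exact Hz].
Qed.

Lemma derivable_eps (f : R -> R) (x l eps : R) :
  derivable_pt_lim f x l -> 0 < eps ->
  exists d, 0 < d /\ forall z, Rabs (z - x) < d -> Rabs (f z - f x) < eps.
Proof.
intros H. apply continuity_pt_eps, derivable_continuous_pt. now exists l.
Qed.

Lemma Rpower_mvt (a b p : R) : 0 < a -> 0 < b ->
  exists z, Rmin a b <= z <= Rmax a b /\
    Rpower a p - Rpower b p = p * Rpower z (p - 1) * (a - b).
Proof.
intros Ha Hb.
assert (Hpos : forall x, Rmin b a <= x -> 0 < x).
{ intros x Hx. assert (0 < Rmin b a) by (apply Rmin_glb_lt; lra). lra. }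
destruct (MVT_gen (fun x => Rpower x p) b a (fun x => p * Rpower x (p - 1)))
  as (z & Hz & Hz').
- intros x Hx. apply is_derive_Reals, derivable_pt_lim_power, Hpos. lra.
- intros x Hx. apply derivable_continuous_pt. eexists.
  apply derivable_pt_lim_power, Hpos. lra.
- exists z. rewrite (Rmin_comm a), (Rmax_comm a). auto.
Qed.

Lemma Rpower_lipschitz (a b p M : R) : 1 < p -> 0 < a <= M -> 0 < b <= M ->
  Rabs (Rpower a p - Rpower b p) <= p * Rpower M (p - 1) * Rabs (a - b).
Proof.
intros Hp Ha Hb. destruct (Rpower_mvt a b p) as (z & Hz & ->); [lra|lra|].
assert (0 < Rmin a b) by (apply Rmin_glb_lt; lra).
assert (Rmax a b <= M) by (apply Rmax_lub; lra).
assert (Rpower z (p - 1) <= Rpower M (p - 1)) by (apply Rle_Rpower_l; lra).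
assert (Hz0 := Rpower_pos z (p - 1)).
rewrite Rabs_mult, (Rabs_pos_eq (p * _)) by nra.
apply Rmult_le_compat_r; [apply Rabs_pos | nra].
Qed.

(** The slack [C >= 1] replaces a square root: [D <= C <= C^2]. *)
Lemma Rabs_le_of_sq (x c C D : R) : 0 <= c -> 1 <= C -> x ^ 2 <= D * c ^ 2 -> D <= C ->
  Rabs x <= C * c.
Proof.
intros Hc HC Hx HD. apply Rnot_lt_le. intros H.
assert (H0 : 0 <= C * c) by nra.
assert ((C * c) ^ 2 < Rabs x ^ 2) by nra.
rewrite pow2_abs in H1. assert (0 <= c ^ 2) by apply pow2_ge_0.
assert (D * c ^ 2 <= C * c ^ 2) by nra.
assert (C * c ^ 2 <= C ^ 2 * c ^ 2) by (apply Rmult_le_compat_r; nra). nra.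
Qed.

(* With [k = al / 2], the Lyapunov function is
   [w'^2 / 2 + k w w' + k^2 w^2 + q w^2 / 2]. *)
Lemma damped_oscillator_stable (al q : R) : 0 < al -> 0 < q ->
  exists sig C, 0 < sig /\ 1 <= C /\
  forall (w w1 w2 : R -> R) a b d, a <= b ->
  (forall t, a <= t <= b ->
     derivable_pt_lim w t (w1 t) /\ derivable_pt_lim w1 t (w2 t) /\
     Rabs (w2 t + al * w1 t + q * w t) <= sig * Rabs (w t)) ->
  Rabs (w a) <= d -> Rabs (w1 a) <= d ->
  Rabs (w b) <= C * d /\ Rabs (w1 b) <= C * d.
Proof.
intros Hal Hq. set (k := al / 2). assert (Hk : 0 < k) by (unfold k; lra).
(* With [e] the error in the oscillator equation, the Lyapunov derivative is
   [- k w'^2 - k q w^2 + (w' + k w) e]. The two bounds on [sig] let the first two terms absorb the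
   last one when [|e| <= sig |w|]. *)
set (sig := Rmin k (k * q / (1 + k))).
assert (Hsig : 0 < sig).
{ apply Rmin_glb_lt; [lra|]. apply Rdiv_lt_0_compat; nra. }
assert (Hs1 : sig <= k) by apply Rmin_l.
assert (Hs2 : sig * (1 + k) <= k * q).
{ replace (k * q) with (k * q / (1 + k) * (1 + k)) by (field; lra).
  apply Rmult_le_compat_r; [lra | apply Rmin_r]. }
set (D := 1 + k + k ^ 2 + q).
assert (Hk2 : 0 < k ^ 2) by nra.
assert (HD : 1 < D) by (unfold D; lra).
assert (Hq2 : 0 < 2 / q) by (apply Rdiv_lt_0_compat; lra).
exists sig, (D * (4 + 2 / q)). split; [assumption|]. split; [nra|].
intros w w1 w2 a b d Hab H Ha Ha1.
assert (Hd : 0 <= d) by (eapply Rle_trans; [apply Rabs_pos | exact Ha]).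
set (V := fun t => w1 t ^ 2 / 2 + k * (w t * w1 t) + k ^ 2 * w t ^ 2 + q * w t ^ 2 / 2).
set (V' := fun t => w1 t * w2 t + k * (w1 t * w1 t + w t * w2 t)
   + 2 * k ^ 2 * (w t * w1 t) + q * (w t * w1 t)).
assert (HV : V b <= V a).
{ apply deriv_nonpos_le with V'; [assumption| |].
  - intros t Ht. destruct (H t Ht) as (D1 & D2 & _).
    apply is_derive_Reals in D1, D2. apply is_derive_Reals. unfold V, V'.
    auto_derive; [repeat split; eexists; eassumption|]. rewrite_derives. field.
  - intros t Ht. destruct (H t ltac:(lra)) as (_ & _ & E). unfold V'.
    set (e := w2 t + al * w1 t + q * w t) in *.
    replace (w2 t) with (e - 2 * k * w1 t - q * w t) by (unfold e, k; field).
    assert (Ew1 : w1 t * e <= sig * (w t ^ 2 / 2 + w1 t ^ 2 / 2)).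
    { eapply Rle_trans; [apply Rle_abs|]. rewrite Rabs_mult.
      apply Rle_trans with (Rabs (w1 t) * (sig * Rabs (w t))).
      - apply Rmult_le_compat_l; [apply Rabs_pos | exact E].
      - rewrite <- (pow2_abs (w t)), <- (pow2_abs (w1 t)).
        assert (0 <= (Rabs (w1 t) - Rabs (w t)) ^ 2) by apply pow2_ge_0. nra. }
    assert (Ew : w t * e <= sig * w t ^ 2).
    { eapply Rle_trans; [apply Rle_abs|]. rewrite Rabs_mult.
      apply Rle_trans with (Rabs (w t) * (sig * Rabs (w t))).
      - apply Rmult_le_compat_l; [apply Rabs_pos | exact E].
      - rewrite <- (pow2_abs (w t)). right; ring. }
    assert (0 <= w t ^ 2) by apply pow2_ge_0. assert (0 <= w1 t ^ 2) by apply pow2_ge_0.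
    assert (k * (w t * e) <= k * (sig * w t ^ 2)) by (apply Rmult_le_compat_l; lra).
    assert (sig * (1 + k) * w t ^ 2 <= k * q * w t ^ 2) by (apply Rmult_le_compat_r; lra).
    assert (sig * w1 t ^ 2 <= k * w1 t ^ 2) by (apply Rmult_le_compat_r; lra).
    nra. }
assert (HVa : V a <= D * d ^ 2).
{ unfold V, D.
  assert (w a ^ 2 <= d ^ 2) by (rewrite <- (pow2_abs (w a)); apply pow_incr; split; [apply Rabs_pos | lra]).
  assert (w1 a ^ 2 <= d ^ 2) by (rewrite <- (pow2_abs (w1 a)); apply pow_incr; split; [apply Rabs_pos | lra]).
  assert (w a * w1 a <= d ^ 2) by (assert (0 <= (w a - w1 a) ^ 2) by apply pow2_ge_0; nra).
  assert (k * (w a * w1 a) <= k * d ^ 2) by (apply Rmult_le_compat_l; lra).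
  assert (k ^ 2 * w a ^ 2 <= k ^ 2 * d ^ 2) by (apply Rmult_le_compat_l; lra).
  assert (q * w a ^ 2 <= q * d ^ 2) by (apply Rmult_le_compat_l; lra).
  assert (0 <= d ^ 2) by apply pow2_ge_0. nra. }
(* Coercivity by completing the square: the difference of the two sides is [(w'/2 + k w)^2]. *)
assert (HVb : w1 b ^ 2 / 4 + q * w b ^ 2 / 2 <= V b).
{ unfold V. assert (0 <= (w1 b / 2 + k * w b) ^ 2) by apply pow2_ge_0. nra. }
assert (0 <= w b ^ 2) by apply pow2_ge_0. assert (0 <= w1 b ^ 2) by apply pow2_ge_0.
split.
- apply (Rabs_le_of_sq _ _ _ (D * (2 / q))); [assumption|nra| |nra].
  apply Rmult_le_reg_l with (q / 2); [lra|].
  replace (q / 2 * (D * (2 / q) * d ^ 2)) with (D * d ^ 2) by (field; lra). nra.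
- apply (Rabs_le_of_sq _ _ _ (D * 4)); [assumption|nra| |nra]. nra.
Qed.

(** No damping is assumed, so the constant grows with [len]; it serves only on an interval fixed
    beforehand. *)
Lemma gronwall_second_order (K len : R) : 0 <= K -> 0 <= len ->
  exists C, 1 <= C /\
  forall (w w1 w2 : R -> R) a b d, a <= b <= a + len ->
  (forall t, a <= t <= b ->
     derivable_pt_lim w t (w1 t) /\ derivable_pt_lim w1 t (w2 t) /\
     Rabs (w2 t) <= K * (Rabs (w t) + Rabs (w1 t))) ->
  Rabs (w a) <= d -> Rabs (w1 a) <= d ->
  Rabs (w b) <= C * d /\ Rabs (w1 b) <= C * d.
Proof.
(* The derivative of [w^2 + w'^2] is at most [L] times itself: [1] comes from [2 w w'], and [3 K]
   from [2 w' w'']. *)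
intros HK Hlen. set (L := 1 + 3 * K). assert (HL : 1 <= L) by (unfold L; lra).
assert (Hexp : 1 <= exp (L * len)) by (rewrite <- exp_0; apply exp_le_mono; nra).
exists (2 * exp (L * len)). split; [lra|].
intros w w1 w2 a b d Hab H Ha Ha1.
assert (Hd : 0 <= d) by (eapply Rle_trans; [apply Rabs_pos | exact Ha]).
set (V := fun t => exp (- (L * t)) * (w t ^ 2 + w1 t ^ 2)).
set (V' := fun t => exp (- (L * t)) *
   (2 * w t * w1 t + 2 * w1 t * w2 t - L * (w t ^ 2 + w1 t ^ 2))).
assert (HV : V b <= V a).
{ apply deriv_nonpos_le with V'; [lra| |].
  - intros t Ht. destruct (H t Ht) as (D1 & D2 & _).
    apply is_derive_Reals in D1, D2. apply is_derive_Reals. unfold V, V'.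
    auto_derive; [repeat split; eexists; eassumption|]. rewrite_derives. ring.
  - intros t Ht. destruct (H t ltac:(lra)) as (_ & _ & E). unfold V'.
    assert (0 < exp (- (L * t))) by apply exp_pos.
    assert (2 * w t * w1 t + 2 * w1 t * w2 t - L * (w t ^ 2 + w1 t ^ 2) <= 0); [|nra].
    assert (E1 : w1 t * w2 t <= K * (Rabs (w1 t) * Rabs (w t) + Rabs (w1 t) ^ 2)).
    { eapply Rle_trans; [apply Rle_abs|]. rewrite Rabs_mult.
      apply Rle_trans with (Rabs (w1 t) * (K * (Rabs (w t) + Rabs (w1 t)))).
      - apply Rmult_le_compat_l; [apply Rabs_pos | exact E].
      - right; ring. }
    assert (E2 : Rabs (w1 t) * Rabs (w t) <= (w t ^ 2 + w1 t ^ 2) / 2).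
    { rewrite <- (pow2_abs (w t)), <- (pow2_abs (w1 t)).
      assert (0 <= (Rabs (w1 t) - Rabs (w t)) ^ 2) by apply pow2_ge_0. nra. }
    rewrite pow2_abs in E1.
    assert (0 <= w t ^ 2) by apply pow2_ge_0.
    assert (K * (Rabs (w1 t) * Rabs (w t) + w1 t ^ 2)
      <= K * ((w t ^ 2 + w1 t ^ 2) / 2 + w1 t ^ 2)) by (apply Rmult_le_compat_l; lra).
    assert (0 <= K * w t ^ 2) by nra.
    assert (0 <= (w t - w1 t) ^ 2) by apply pow2_ge_0.
    unfold L. nra. }
assert (HS : w b ^ 2 + w1 b ^ 2 <= 2 * exp (L * len) * d ^ 2).
{ assert (HVb : w b ^ 2 + w1 b ^ 2 = exp (L * b) * V b).
  { unfold V. rewrite <- Rmult_assoc, <- exp_plus.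
    replace (L * b + - (L * b)) with 0 by ring. rewrite exp_0. ring. }
  rewrite HVb.
  apply Rle_trans with (exp (L * b) * V a).
  { apply Rmult_le_compat_l; [left; apply exp_pos | exact HV]. }
  unfold V. rewrite <- Rmult_assoc, <- exp_plus.
  assert (w a ^ 2 <= d ^ 2) by (rewrite <- (pow2_abs (w a)); apply pow_incr; split; [apply Rabs_pos | lra]).
  assert (w1 a ^ 2 <= d ^ 2) by (rewrite <- (pow2_abs (w1 a)); apply pow_incr; split; [apply Rabs_pos | lra]).
  replace (2 * exp (L * len) * d ^ 2) with (exp (L * len) * (2 * d ^ 2)) by ring.
  assert (0 <= w a ^ 2) by apply pow2_ge_0.
  assert (0 <= w1 a ^ 2) by apply pow2_ge_0.
  apply Rmult_le_compat; [left; apply exp_pos | lra | apply exp_le_mono; nra | lra]. }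
assert (0 <= w b ^ 2) by apply pow2_ge_0. assert (0 <= w1 b ^ 2) by apply pow2_ge_0.
split; apply (Rabs_le_of_sq _ _ _ (2 * exp (L * len))); lra.
Qed.

(** * Convergence in logarithmic time *)

(** Only [y -> 1] is assumed of [y^*]; [y' -> 0] must be derived. The mean value theorem on
    [[t-1, t]] finds a point with small [y'], and [(e^(al t) y')' = e^(al t) (y'' + al y')], whose
    last factor is small by the equation, carries the smallness on to [t]. *)
Lemma emden_limit_deriv (m al p T : R) (y y1 y2 : R -> R) :
  0 < m -> 0 < al -> 1 < p -> emden_sol m al p T y y1 y2 ->
  (forall eps, 0 < eps -> exists T', forall t, t < T' -> Rabs (y t - 1) < eps) ->
  forall eps, 0 < eps -> exists T', T' <= T /\
    forall t, t <= T' -> Rabs (y t - 1) < eps /\ Rabs (y1 t) < eps.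
Proof.
intros Hm Hal Hp Hy Hlim eps He.
set (L := p * Rpower 2 (p - 1)).
assert (HL : 0 < L) by (apply Rmult_lt_0_compat; [lra | apply Rpower_pos]).
set (d := Rmin (1 / 2) (eps / (8 * (1 + L)))).
assert (Hd : 0 < d) by (apply Rmin_glb_lt; [lra | apply Rdiv_lt_0_compat; lra]).
assert (Hd1 : d <= 1 / 2) by apply Rmin_l.
assert (Hd2 : d * (8 * (1 + L)) <= eps).
{ apply Rle_trans with (eps / (8 * (1 + L)) * (8 * (1 + L))); [|right; field; lra].
  apply Rmult_le_compat_r; [lra | apply Rmin_r]. }
destruct (Hlim d Hd) as (Ta & HTa).
destruct (forcing_small m (Rmin T (Ta - 1)) d Hm Hd) as (Tb & HTb & Hf).
assert (HTb1 := Rle_trans _ _ _ HTb (Rmin_l _ _)).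
assert (HTb2 := Rle_trans _ _ _ HTb (Rmin_r _ _)).
exists Tb. split; [assumption|]. intros t Ht.
assert (Hyd : forall z, z <= Tb -> 1 - d < y z < 1 + d).
{ intros z Hz. assert (H := HTa z ltac:(lra)). apply Rabs_lt_between in H. lra. }
split.
{ apply Rlt_le_trans with d; [apply HTa; lra | nra]. }
assert (Hr : forall z, z <= Tb -> Rabs (y2 z + al * y1 z) <= 4 * (1 + L) * d).
{ intros z Hz. destruct (Hy z ltac:(lra)) as (_ & _ & _ & E).
  assert (Hz2 := Hyd z Hz). destruct (Hf z Hz) as [h0 h1].
  assert (HR := Rpower_lipschitz (y z) 1 p 2 Hp ltac:(lra) ltac:(lra)).
  fold L in HR. rewrite Rpower_1_l in HR.
  assert (Rabs (y z - 1) <= d) by (apply Rabs_le; lra).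
  assert (Rabs (Rpower (y z) p - 1) <= L * d) by nra.
  assert (HR2 : - (L * d) <= Rpower (y z) p - 1 <= L * d) by (apply Rabs_le_between; assumption).
  set (h := m ^ 2 * exp (2 * m * z)) in *.
  assert (0 <= h * y z <= d * 2) by nra.
  apply Rabs_le. replace (y2 z + al * y1 z) with (y z - Rpower (y z) p + h * y z) by lra.
  nra. }
destruct (MVT_cor2 y y1 (t - 1) t) as (xi & Hxi & Hxi'); [lra| |].
{ intros c Hc. apply (Hy c). lra. }
assert (Hyx : Rabs (y1 xi) <= 2 * d).
{ assert (Ha := Hyd t Ht). assert (Hb := Hyd (t - 1) ltac:(lra)). apply Rabs_le. lra. }
destruct (MVT_cor2 (fun z => exp (al * z) * y1 z)
   (fun z => exp (al * z) * (y2 z + al * y1 z)) xi t) as (c & Hc & Hc'); [lra| |].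
{ intros c Hc. destruct (Hy c ltac:(lra)) as (_ & D & _). apply is_derive_Reals in D.
  apply is_derive_Reals. auto_derive; [repeat split; eexists; eassumption|].
  rewrite_derives. ring. }
assert (Hrc := Hr c ltac:(lra)).
assert (Het : 0 < exp (al * t)) by apply exp_pos.
assert (Hex : 0 < exp (al * xi) <= exp (al * t)).
{ split; [apply exp_pos | apply exp_le_mono; nra]. }
assert (Hec : 0 < exp (al * c) <= exp (al * t)).
{ split; [apply exp_pos | apply exp_le_mono; nra]. }
assert (Hkey : Rabs (exp (al * t) * y1 t) <= exp (al * t) * (2 * d + 4 * (1 + L) * d)).
{ replace (exp (al * t) * y1 t)
    with (exp (al * xi) * y1 xi + exp (al * c) * ((y2 c + al * y1 c) * (t - xi))) by lra.
  eapply Rle_trans; [apply Rabs_triang|].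
  rewrite Rmult_plus_distr_l. apply Rplus_le_compat; rewrite Rabs_mult, Rabs_pos_eq by lra.
  - apply Rmult_le_compat; try lra. apply Rabs_pos.
  - apply Rmult_le_compat; try lra; [apply Rabs_pos|].
    rewrite Rabs_mult, (Rabs_pos_eq (t - xi)) by lra.
    assert (0 <= Rabs (y2 c + al * y1 c)) by apply Rabs_pos. nra. }
rewrite Rabs_mult, (Rabs_pos_eq (exp (al * t))) in Hkey by lra.
apply Rmult_le_reg_l in Hkey; [|assumption]. nra.
Qed.

(** The content is that [tau0] is chosen before [Y] and [tau]. The constants are therefore fixed
    backwards in time: first the trapping time [t0] and the stability factors [C1], [C2], then the
    tolerance they demand at the quiet time, and last the early interval on which that time is
    found. *)
Theorem emden_convergence (m al p T M eta : R) (y y1 y2 : R -> R) :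
  0 < m -> 0 < al -> 1 < p -> 0 < M -> 0 < eta ->
  emden_sol m al p T y y1 y2 ->
  (forall eps, 0 < eps -> exists T', forall t, t < T' -> Rabs (y t - 1) < eps) ->
  forall tlo eps, tlo <= T -> 0 < eps ->
  exists tau0, forall Y Y1 Y2 tau,
    emden_sol m al p T Y Y1 Y2 -> tau <= tau0 ->
    (forall t, t <= T -> Y t <= M /\ Rabs (Y1 t) <= M) ->
    (forall t, tau <= t <= T -> energy m p Y Y1 t <= - eta) ->
    forall t, tlo <= t <= T ->
      Rabs (Y t - y t) < eps /\ Rabs (Y1 t - y1 t) < eps /\ Rabs (Y2 t - y2 t) < eps.
Proof.
intros Hm Hal Hp HM Heta Hy Hlim tlo eps Htlo Heps.
destruct (damped_oscillator_stable al (p - 1) Hal ltac:(lra))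
  as (sig & C1 & Hsig & HC1 & Hstab).
(* The difference [w = Y - y] has restoring coefficient [p z^(p-1) - 1 - h] with [z] between [Y] and
   [y]. It differs from [p - 1] by this function and the forcing [h]; each receives half of
   [sig]. *)
destruct (derivable_eps (fun z => p * (Rpower z (p - 1) - 1)) 1
   (p * ((p - 1) * Rpower 1 (p - 1 - 1))) (sig / 2)) as (rho0 & Hrho0 & Hrhoc).
{ apply is_derive_Reals. unfold Rpower. auto_derive; [lra|].
  rewrite ln_1, !Rmult_0_r, exp_0. field. }
{ lra. }
rewrite Rpower_1_l, Rminus_diag, Rmult_0_r in Hrhoc.
set (rho := Rmin (1 / 2) rho0).
assert (Hrho : 0 < rho <= 1 / 2) by (split; [apply Rmin_glb_lt; lra | apply Rmin_l]).
assert (Hrho' : rho <= rho0) by apply Rmin_r.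
destruct (well_min p rho Hp ltac:(lra)) as (g & Hg & Hwell).
destruct (derivable_eps (well p) 1 _ (g / 4) (well_deriv p 1 Hp Rlt_0_1) ltac:(lra))
  as (d1 & Hd1 & Hwc).
destruct (emden_limit_deriv m al p T y y1 y2 Hm Hal Hp Hy Hlim rho ltac:(lra))
  as (Ta & HTa & Hya).
destruct (forcing_small m (Rmin tlo Ta) (Rmin (sig / 2) (g / M ^ 2)) Hm)
  as (t0 & Ht0 & Hf).
{ apply Rmin_glb_lt; [lra | apply Rdiv_lt_0_compat; nra]. }
assert (Ht0a := Rle_trans _ _ _ Ht0 (Rmin_l _ _)).
assert (Ht0b := Rle_trans _ _ _ Ht0 (Rmin_r _ _)).
destruct (continuity_ab_maj y t0 T ltac:(lra)) as (tm & Htm & _).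
{ intros c Hc. apply derivable_continuous_pt. exists (y1 c). apply (Hy c). lra. }
set (MM := Rmax M (y tm)).
assert (HMM : M <= MM) by apply Rmax_l.
assert (HyM : forall t, t0 <= t <= T -> y t <= MM).
{ intros t Ht. eapply Rle_trans; [apply (Htm t Ht) | apply Rmax_r]. }
set (L := p * Rpower MM (p - 1)).
assert (HL : 0 < L) by (apply Rmult_lt_0_compat; [lra | apply Rpower_pos]).
set (hT := m ^ 2 * exp (2 * m * T)).
assert (HhT : 0 < hT) by apply (forcing_le m T T Hm (Rle_refl T)).
set (K := al + 1 + hT + L).
assert (HK : 1 <= K) by (unfold K; lra).
destruct (gronwall_second_order K (T - t0) ltac:(lra) ltac:(lra)) as (C2 & HC2 & Hgron).
(* After amplification by [C1] and [C2], [w] and [w'] are below [eps / (2 K + 2)], so that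
   [|w''| <= K (|w| + |w'|)] is below [eps] as well. *)
set (d := eps / (2 * K + 2) / (C1 * C2)).
assert (HCC : 0 < C1 * C2) by (apply Rmult_lt_0_compat; lra).
assert (Hd : 0 < d) by (apply Rdiv_lt_0_compat; [apply Rdiv_lt_0_compat; lra | lra]).
set (del := Rmin (Rmin 1 (d / 2)) (Rmin d1 (g / 4))).
assert (Hdel : 0 < del) by (unfold del; repeat apply Rmin_glb_lt; lra).
assert (Hdel1 : del <= 1) by (eapply Rle_trans; apply Rmin_l).
assert (Hdel2 : del <= d / 2) by (eapply Rle_trans; [apply Rmin_l | apply Rmin_r]).
assert (Hdel3 : del <= d1) by (eapply Rle_trans; [apply Rmin_r | apply Rmin_l]).
assert (Hdel4 : del <= g / 4) by (eapply Rle_trans; [apply Rmin_r | apply Rmin_r]).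
destruct (emden_limit_deriv m al p T y y1 y2 Hm Hal Hp Hy Hlim (d / 2) ltac:(lra))
  as (Tb & HTb & Hyb).
destruct (quiet_time m al p M (Rmin t0 Tb) eta del Hm Hal Hp HM Heta Hdel)
  as (T1 & tau0 & (Htau0 & HT1) & Hquiet).
assert (HT1a := Rle_trans _ _ _ HT1 (Rmin_l _ _)).
assert (HT1b := Rle_trans _ _ _ HT1 (Rmin_r _ _)).
exists tau0. intros Y Y1 Y2 tau HY Htau HYM HYE.
destruct (Hquiet Y Y1 Y2) with (tau := tau) as (t1 & Ht1 & Hq1 & Hq2).
{ intros t Ht. apply HY. lra. }
{ assumption. }
{ intros t Ht. destruct (HYM t ltac:(lra)). repeat split; try assumption.
  apply HYE. lra. }
destruct (Hyb t1 ltac:(lra)) as (Hyb1 & Hyb2).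
set (w := fun t => Y t - y t). set (w1 := fun t => Y1 t - y1 t).
set (w2 := fun t => Y2 t - y2 t).
assert (Hw : forall t, t <= T -> derivable_pt_lim w t (w1 t) /\ derivable_pt_lim w1 t (w2 t)).
{ intros t Ht. destruct (HY t Ht) as (DY & DY1 & _). destruct (Hy t Ht) as (Dy & Dy1 & _).
  split; apply derivable_pt_lim_minus; assumption. }
assert (Heq : forall t, t <= T -> w2 t = - al * w1 t + (1 + m ^ 2 * exp (2 * m * t)) * w t
    - (Rpower (Y t) p - Rpower (y t) p)).
{ intros t Ht. destruct (HY t Ht) as (_ & _ & _ & EY). destruct (Hy t Ht) as (_ & _ & _ & Ey).
  unfold w, w1, w2. lra. }
(* Energy budget above [well p 1]: [g/4] from the potential at [t1], [g/8] from the kinetic part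
   there, [g/2] from the forcing at [t]; the total stays below the barrier [g]. *)
assert (Htrap : forall t, t1 <= t <= t0 -> Rabs (Y t - 1) < rho).
{ intros t Ht. destruct (HY t ltac:(lra)) as (_ & _ & Hpos & _).
  apply Hwell; [exact Hpos|].
  assert (HEd := energy_decr m al p T Y Y1 Y2 t1 t Hm Hal Hp HY ltac:(lra)).
  unfold energy in HEd.
  destruct (Hf t ltac:(lra)) as [h0 h1].
  assert (h2 := Rle_trans _ _ _ h1 (Rmin_r _ _)).
  destruct (Hf t1 ltac:(lra)) as [h3 _].
  set (h := m ^ 2 * exp (2 * m * t)) in *.
  assert (HYt : Y t ^ 2 <= M ^ 2) by (apply pow_incr; destruct (HYM t ltac:(lra)); lra).
  assert (h * Y t ^ 2 <= g).
  { replace g with (g / M ^ 2 * M ^ 2) by (field; lra).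
    apply Rmult_le_compat; [lra | apply pow2_ge_0 | lra | lra]. }
  assert (Hw1 := Hwc (Y t1) ltac:(lra)). apply Rabs_lt_between in Hw1.
  assert (Y1 t1 ^ 2 <= del ^ 2).
  { rewrite <- (pow2_abs (Y1 t1)). apply pow_incr. split; [apply Rabs_pos | lra]. }
  assert (del * del <= 1 * del) by (apply Rmult_le_compat_r; lra).
  assert (0 <= Y1 t ^ 2) by apply pow2_ge_0.
  assert (0 <= m ^ 2 * exp (2 * m * t1) * Y t1 ^ 2)
    by (apply Rmult_le_pos; [lra | apply pow2_ge_0]).
  lra. }
assert (Hmid : Rabs (w t0) <= C1 * d /\ Rabs (w1 t0) <= C1 * d).
{ apply (Hstab w w1 w2 t1 t0 d); [lra| | |].
  - intros t Ht. destruct (Hw t ltac:(lra)) as (Dw & Dw1). repeat split; try assumption.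
    rewrite (Heq t) by lra.
    destruct (HY t ltac:(lra)) as (_ & _ & HpY & _).
    destruct (Hy t ltac:(lra)) as (_ & _ & Hpy & _).
    destruct (Rpower_mvt (Y t) (y t) p HpY Hpy) as (z & Hz & ->).
    fold (w t).
    assert (Ha := Htrap t Ht). destruct (Hya t ltac:(lra)) as (Hb & _).
    assert (Hzr : Rabs (z - 1) < rho).
    { apply Rabs_lt_between in Ha, Hb.
      assert (1 - rho < Rmin (Y t) (y t)) by (apply Rmin_glb_lt; lra).
      assert (Rmax (Y t) (y t) < 1 + rho) by (apply Rmax_lub_lt; lra).
      apply Rabs_def1; lra. }
    assert (Hc := Hrhoc z ltac:(lra)). rewrite Rminus_0_r in Hc.
    destruct (Hf t ltac:(lra)) as [h0 h1].
    assert (h2 := Rle_trans _ _ _ h1 (Rmin_l _ _)).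
    set (h := m ^ 2 * exp (2 * m * t)) in *.
    replace (- al * w1 t + (1 + h) * w t - p * Rpower z (p - 1) * w t + al * w1 t + (p - 1) * w t)
      with ((h - p * (Rpower z (p - 1) - 1)) * w t) by ring.
    rewrite Rabs_mult. apply Rmult_le_compat_r; [apply Rabs_pos|].
    apply Rabs_lt_between in Hc. apply Rabs_le. lra.
  - unfold w. replace (Y t1 - y t1) with ((Y t1 - 1) - (y t1 - 1)) by ring.
    eapply Rle_trans; [apply Rabs_triang|]. rewrite Rabs_Ropp. lra.
  - unfold w1. eapply Rle_trans; [apply Rabs_triang|]. rewrite Rabs_Ropp. lra. }
destruct Hmid as (Hm0 & Hm1).
assert (Hw2 : forall t, t0 <= t <= T -> Rabs (w2 t) <= K * (Rabs (w t) + Rabs (w1 t))).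
{ intros t Ht. rewrite (Heq t) by lra.
  destruct (HY t ltac:(lra)) as (_ & _ & HpY & _).
  destruct (Hy t ltac:(lra)) as (_ & _ & Hpy & _).
  assert (HLip : Rabs (Rpower (Y t) p - Rpower (y t) p) <= L * Rabs (w t)).
  { apply Rpower_lipschitz; [lra| |].
    - destruct (HYM t ltac:(lra)). lra.
    - specialize (HyM t Ht). lra. }
  destruct (forcing_le m t T Hm ltac:(lra)) as [h0 h1]. fold hT in h1.
  set (h := m ^ 2 * exp (2 * m * t)) in *.
  eapply Rle_trans; [apply Rabs_triang|]. rewrite Rabs_Ropp.
  assert (Rabs (- al * w1 t + (1 + h) * w t) <= al * Rabs (w1 t) + (1 + hT) * Rabs (w t)).
  { eapply Rle_trans; [apply Rabs_triang|]. rewrite !Rabs_mult.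
    rewrite Rabs_Ropp, (Rabs_pos_eq al), (Rabs_pos_eq (1 + h)) by lra.
    assert ((1 + h) * Rabs (w t) <= (1 + hT) * Rabs (w t)); [|lra].
    apply Rmult_le_compat_r; [apply Rabs_pos | lra]. }
  assert (0 <= Rabs (w t)) by apply Rabs_pos. assert (0 <= Rabs (w1 t)) by apply Rabs_pos.
  assert (0 <= al * Rabs (w t)) by (apply Rmult_le_pos; lra).
  assert (0 <= (1 + hT + L) * Rabs (w1 t)) by (apply Rmult_le_pos; lra).
  unfold K. lra. }
intros t Ht.
assert (Hfin : Rabs (w t) <= C2 * (C1 * d) /\ Rabs (w1 t) <= C2 * (C1 * d)).
{ apply (Hgron w w1 w2 t0 t (C1 * d)); [lra| |assumption|assumption].
  intros z Hz. destruct (Hw z ltac:(lra)). repeat split; try assumption. apply Hw2. lra. }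
replace (C2 * (C1 * d)) with (eps / (2 * K + 2)) in Hfin by (unfold d; field; repeat split; lra).
destruct Hfin as (Hf0 & Hf1).
assert (Hw2t := Hw2 t ltac:(lra)).
set (e := eps / (2 * K + 2)) in *.
assert (He : e * (2 * K + 2) = eps) by (unfold e; field; lra).
assert (He0 : 0 < e) by (apply Rdiv_lt_0_compat; lra).
fold (w t) (w1 t) (w2 t).
assert (K * (Rabs (w t) + Rabs (w1 t)) <= K * (e + e)) by (apply Rmult_le_compat_l; lra).
assert (1 * e <= K * e) by (apply Rmult_le_compat_r; lra).
repeat split; lra.
Qed.

(** * Regular solutions in Emden-Fowler variables *)

(** Supercriticality enters as [2 theta < N - 2], which gives [alpha > 0]. The last two identities
    are why [m] and [A] are chosen so: they normalise the coefficients of [y] and [y^p] to [1]. *)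
Lemma emden_constants (N : nat) (p : R) : (3 <= N)%nat -> pS N < p ->
  1 < p /\ 0 < theta p /\ 0 < Aconst N p /\ 0 < mconst N p /\ 0 < alpha N p /\
  theta p * (p - 1) = 2 /\
  mconst N p ^ 2 * (theta p * (INR N - 2 - theta p)) = 1 /\
  mconst N p ^ 2 * Rpower (Aconst N p) (p - 1) = 1.
Proof.
intros HN Hp. assert (Hn : 3 <= INR N) by (apply (le_INR 3) in HN; simpl in HN; lra).
unfold pS in Hp. set (n := INR N) in *.
assert (Hp' : 4 / (n - 2) < p - 1).
{ replace (4 / (n - 2)) with ((n + 2) / (n - 2) - 1) by (field; lra). lra. }
assert (H4 : 0 < 4 / (n - 2)) by (apply Rdiv_lt_0_compat; lra).
assert (Hth : 0 < theta p) by (apply Rdiv_lt_0_compat; lra).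
assert (Hthp : theta p * (p - 1) = 2) by (unfold theta; field; lra).
assert (Hth2 : 2 * theta p < n - 2).
{ apply Rmult_lt_reg_r with (p - 1); [lra|].
  replace (2 * theta p * (p - 1)) with 4 by lra.
  replace 4 with ((n - 2) * (4 / (n - 2))) by (field; lra).
  apply Rmult_lt_compat_l; lra. }
assert (HB : 0 < theta p * (n - 2 - theta p)) by (apply Rmult_lt_0_compat; lra).
assert (HsB : 0 < sqrt (theta p * (n - 2 - theta p))) by now apply sqrt_lt_R0.
assert (Hm : 0 < mconst N p) by now apply Rinv_0_lt_compat.
assert (Hm2 : mconst N p ^ 2 * (theta p * (n - 2 - theta p)) = 1).
{ unfold mconst. fold n. rewrite <- (pow2_sqrt (theta p * (n - 2 - theta p))) at 2 by lra.
  field. lra. }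
repeat split; try assumption; try lra.
- apply Rpower_pos.
- apply Rmult_lt_0_compat; [assumption | fold n; lra].
- unfold Aconst. fold n. rewrite Rpower_mult.
  replace (1 / (p - 1) * (p - 1)) with 1 by (field; lra).
  now rewrite Rpower_1.
Qed.

Definition EF (N : nat) (p : R) (u : R -> R) (t : R) : R :=
  let m := mconst N p in
  exp (m * theta p * t) * u (exp (m * t)) / Aconst N p.

Definition EF1 (N : nat) (p : R) (u u1 : R -> R) (t : R) : R :=
  let m := mconst N p in let s := exp (m * t) in
  m * exp (m * theta p * t) * (theta p * u s + s * u1 s) / Aconst N p.

(** Since [d/dt = m s d/ds], the bracket is [(s d/ds + theta)^2 u] expanded. *)
Definition EF2 (N : nat) (p : R) (u u1 u2 : R -> R) (t : R) : R :=
  let m := mconst N p in let s := exp (m * t) in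
  m ^ 2 * exp (m * theta p * t) *
    (theta p ^ 2 * u s + (2 * theta p + 1) * (s * u1 s) + s ^ 2 * u2 s) / Aconst N p.

Lemma EF_deriv (N : nat) (p : R) (u u1 : R -> R) (t : R) :
  derivable_pt_lim u (exp (mconst N p * t)) (u1 (exp (mconst N p * t))) ->
  derivable_pt_lim (EF N p u) t (EF1 N p u u1 t).
Proof.
intros D. apply is_derive_Reals in D. apply is_derive_Reals. unfold EF, EF1, Rdiv.
set (iA := / Aconst N p).
auto_derive; [repeat split; eexists; eassumption|]. rewrite_derives. ring.
Qed.

Lemma EF1_deriv (N : nat) (p : R) (u u1 u2 : R -> R) (t : R) :
  derivable_pt_lim u (exp (mconst N p * t)) (u1 (exp (mconst N p * t))) ->
  derivable_pt_lim u1 (exp (mconst N p * t)) (u2 (exp (mconst N p * t))) ->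
  derivable_pt_lim (EF1 N p u u1) t (EF2 N p u u1 u2 t).
Proof.
intros D D'. apply is_derive_Reals in D, D'. apply is_derive_Reals.
unfold EF1, EF2, Rdiv. set (iA := / Aconst N p).
auto_derive; [repeat split; eexists; eassumption|]. rewrite_derives. ring.
Qed.

Lemma exp_le_of_le_ln (m t S : R) : 0 < m -> 0 < S -> t <= ln S / m -> exp (m * t) <= S.
Proof.
intros Hm HS Ht. rewrite <- (exp_ln S HS). apply exp_le_mono.
replace (ln S) with (m * (ln S / m)) by (field; lra). apply Rmult_le_compat_l; lra.
Qed.

Lemma rad_sol_emden (N : nat) (p gam T : R) (v v1 v2 : R -> R) :
  (3 <= N)%nat -> pS N < p -> 0 < T -> rad_sol N p gam T v v1 v2 ->
  emden_sol (mconst N p) (alpha N p) p (ln T / mconst N p)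
    (EF N p v) (EF1 N p v v1) (EF2 N p v v1 v2).
Proof.
intros HN Hp HT (_ & _ & Hv) t Ht.
destruct (emden_constants N p HN Hp) as (Hp1 & Hth & HA & Hm & Hal & Hthp & Hm2 & HmA).
set (s := exp (mconst N p * t)).
assert (Hs : 0 < s) by apply exp_pos.
assert (HsT : s <= T) by now apply exp_le_of_le_ln.
destruct (Hv s ltac:(lra)) as (D1 & D2 & Hpos & E). specialize (E Hs).
split; [now apply EF_deriv|]. split; [now apply EF1_deriv|].
assert (HY : 0 < EF N p v t).
{ unfold EF. apply Rdiv_lt_0_compat; [|assumption].
  apply Rmult_lt_0_compat; [apply exp_pos | exact Hpos]. }
split; [assumption|].
rewrite (Rpower_split _ p HY).
assert (Hexp2 : exp (2 * mconst N p * t) = s ^ 2).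
{ unfold s. simpl. rewrite Rmult_1_r, <- exp_plus. f_equal; ring. }
(* Here [theta (p - 1) = 2] turns [(s^theta)^(p-1)] into the [s^2] that multiplies the radial
   equation. *)
assert (HR : Rpower (EF N p v t) (p - 1) = mconst N p ^ 2 * s ^ 2 * Rpower (v s) (p - 1)).
{ assert (HAR : Rpower (Aconst N p) (p - 1) * Rpower (EF N p v t) (p - 1)
    = s ^ 2 * Rpower (v s) (p - 1)).
  { rewrite Rpower_mult_distr by assumption.
    replace (Aconst N p * EF N p v t) with (exp (mconst N p * theta p * t) * v s)
      by (unfold EF; fold s; field; lra).
    rewrite <- Rpower_mult_distr by (assumption || apply exp_pos). f_equal.
    rewrite <- Hexp2. unfold Rpower. rewrite ln_exp. f_equal.
    replace 2 with (theta p * (p - 1)). ring. }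
  rewrite Rmult_assoc, <- HAR, <- Rmult_assoc, HmA. ring. }
rewrite HR, Hexp2. unfold fnl, rpow in E. rewrite (Rpower_split (v s) p Hpos) in E.
unfold alpha, EF2, EF1, EF. fold s.
set (V := Rpower (v s) (p - 1)) in *. set (n := INR N) in *.
set (m := mconst N p) in *. set (th := theta p) in *. set (A := Aconst N p) in *.
assert (Hv2 : s ^ 2 * v2 s = - (n - 1) * (s * v1 s) + s ^ 2 * v s - s ^ 2 * (v s * V)).
{ replace (v2 s) with (- ((n - 1) / s * v1 s) + v s - v s * V) by lra. field. lra. }
rewrite Hv2. clearbody m th A n V.
transitivity (exp (m * th * t) * v s / A * (m ^ 2 * (th * (n - 2 - th)) - 1)).
{ field. lra. }
rewrite Hm2. ring.
Qed.

(** The radial energy [v'^2/2 + well p v] starts at [well p gam] and is dissipated by the term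
    [(N-1)/s v'], while [well p] increases on [[1, oo)]. *)
Lemma rad_sol_le (N : nat) (p gam T : R) (v v1 v2 : R -> R) :
  (3 <= N)%nat -> 1 < p -> 1 <= gam -> rad_sol N p gam T v v1 v2 ->
  forall s, 0 <= s <= T -> v s <= gam.
Proof.
intros HN Hp Hgam (H0 & H1 & Hv) s Hs.
assert (Hn : 3 <= INR N) by (apply (le_INR 3) in HN; simpl in HN; lra).
apply Rnot_lt_le. intros Hlt.
assert (Hw := well_incr p gam (v s) Hp ltac:(lra)).
assert (HE : v1 s ^ 2 / 2 + well p (v s) <= v1 0 ^ 2 / 2 + well p (v 0)).
{ apply (deriv_nonpos_le (fun r => v1 r ^ 2 / 2 + well p (v r))
    (fun r => v1 r * (v2 r + (Rpower (v r) p - v r)))); [lra| |].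
  - intros r Hr. destruct (Hv r ltac:(lra)) as (D1 & D2 & Hpos & _).
    apply is_derive_Reals in D1, D2. apply is_derive_Reals.
    unfold well, Rpower. auto_derive; [repeat split; try lra; eexists; eassumption|].
    rewrite_derives. field. lra.
  - intros r Hr. destruct (Hv r ltac:(lra)) as (_ & _ & _ & E). specialize (E ltac:(lra)).
    unfold fnl, rpow in E.
    replace (v2 r + (Rpower (v r) p - v r)) with (- ((INR N - 1) / r * v1 r)) by lra.
    replace (v1 r * - ((INR N - 1) / r * v1 r)) with (- ((INR N - 1) / r * v1 r ^ 2)) by ring.
    assert (0 <= (INR N - 1) / r) by (apply Rdiv_le_0_compat; lra).
    assert (0 <= v1 r ^ 2) by apply pow2_ge_0. nra. }
rewrite H0, H1 in HE. assert (0 <= v1 s ^ 2) by apply pow2_ge_0. lra.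
Qed.

(** Divergence form: [(s^(N-1) v')' = - s^(N-1) f(v) >= - gam^p s^(N-1)], integrated from [0]. *)
Lemma rad_sol_slope (N : nat) (p gam T : R) (v v1 v2 : R -> R) :
  (3 <= N)%nat -> 1 < p -> 1 <= gam -> rad_sol N p gam T v v1 v2 ->
  forall s, 0 <= s <= T -> - (Rpower gam p * s / INR N) <= v1 s.
Proof.
intros HN Hp Hgam Hr s Hs. assert (Hle := rad_sol_le N p gam T v v1 v2 HN Hp Hgam Hr).
destruct Hr as (H0 & H1 & Hv).
assert (Hn : 3 <= INR N) by (apply (le_INR 3) in HN; simpl in HN; lra).
destruct (Rle_lt_or_eq_dec 0 s ltac:(lra)) as [Hs0 | <-]; [|rewrite H1; right; field; lra].
destruct N as [|[|k]]; [lia|lia|].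
set (n := INR (S (S k))) in *.
assert (Hk : INR (S k) = n - 1) by (unfold n; rewrite (S_INR (S k)); lra).
assert (HW : - (s ^ S k * v1 s + Rpower gam p * s ^ S (S k) / n)
   <= - (0 ^ S k * v1 0 + Rpower gam p * 0 ^ S (S k) / n)).
{ apply (deriv_nonpos_le (fun r => - (r ^ S k * v1 r + Rpower gam p * r ^ S (S k) / n))
   (fun r => - (r ^ S k * v2 r + (n - 1) * r ^ k * v1 r + Rpower gam p * r ^ S k))); [lra| |].
  - intros r Hr. destruct (Hv r ltac:(lra)) as (_ & D2 & _ & _).
    apply is_derive_Reals in D2. apply is_derive_Reals.
    auto_derive; [repeat split; eexists; eassumption|].
    rewrite_derives. rewrite <- Hk.
    change (match k with 0%nat => 1 | S _ => INR k + 1 end) with (INR (S k)).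
    simpl pred. fold n. replace (INR (S k) + 1) with n by lra.
    simpl pow. field. lra.
  - intros r Hr. destruct (Hv r ltac:(lra)) as (_ & _ & Hpos & E). specialize (E ltac:(lra)).
    unfold fnl, rpow in E.
    replace (- _) with (- (r ^ S k * (v2 r + (n - 1) / r * v1 r + Rpower gam p)))
      by (simpl; field; lra).
    assert (0 < r ^ S k) by (apply pow_lt; lra).
    assert (Rpower (v r) p <= Rpower gam p) by (apply Rle_Rpower_l; [lra | split; [lra|apply Hle; lra]]).
    nra. }
rewrite H1 in HW. rewrite (pow_ne_zero (S (S k))) in HW by lia.
assert (Hsk : 0 < s ^ S k) by (apply pow_lt; lra).
apply Rmult_le_reg_l with (s ^ S k); [assumption|].
replace (s ^ S (S k)) with (s * s ^ S k) in HW by reflexivity.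
unfold Rdiv in *. nra.
Qed.

(** The slope bound integrated once more; [c] measures [gam^(p-1) s^2], and [6] and [3] are [2 N]
    and [N] at the worst case [N = 3]. *)
Lemma rad_sol_core (N : nat) (p gam T : R) (v v1 v2 : R -> R) (c : R) :
  (3 <= N)%nat -> 1 < p -> 1 <= gam -> rad_sol N p gam T v v1 v2 ->
  forall s, 0 <= s <= T -> Rpower gam p * s ^ 2 <= c * gam ->
  gam * (1 - c / 6) <= v s /\ - (c * gam / 3) <= s * v1 s.
Proof.
intros HN Hp Hgam Hr s Hs Hc.
assert (Hsl := rad_sol_slope N p gam T v v1 v2 HN Hp Hgam Hr).
destruct Hr as (H0 & H1 & Hv).
assert (Hn : 3 <= INR N) by (apply (le_INR 3) in HN; simpl in HN; lra).
assert (Hg := Rpower_pos gam p). set (G := Rpower gam p) in *. set (n := INR N) in *.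
assert (Hn3 : / n <= / 3) by (apply Rinv_le_contravar; lra).
assert (Hn0 : 0 < / n) by (apply Rinv_0_lt_compat; lra).
assert (HGs : 0 <= G * s ^ 2) by (apply Rmult_le_pos; [lra | apply pow2_ge_0]).
assert (HGn : G * s ^ 2 * / n <= c * gam * / 3) by (apply Rmult_le_compat; lra).
split.
- assert (HW : - (v s + G * s ^ 2 / (2 * n)) <= - (v 0 + G * 0 ^ 2 / (2 * n))).
  { apply (deriv_nonpos_le (fun r => - (v r + G * r ^ 2 / (2 * n)))
     (fun r => - (v1 r + G * r / n))); [lra| |].
    - intros r Hr. destruct (Hv r ltac:(lra)) as (D1 & _).
      apply is_derive_Reals in D1. apply is_derive_Reals.
      auto_derive; [repeat split; eexists; eassumption|]. rewrite_derives. field. lra.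
    - intros r Hr. specialize (Hsl r ltac:(lra)). lra. }
  rewrite H0 in HW.
  replace (G * s ^ 2 / (2 * n)) with (G * s ^ 2 * / n / 2) in HW by (field; lra).
  replace (G * 0 ^ 2 / (2 * n)) with 0 in HW by (field; lra). lra.
- specialize (Hsl s Hs). unfold Rdiv in *.
  assert (s * - (G * s * / n) <= s * v1 s) by (apply Rmult_le_compat_l; lra). lra.
Qed.

(** Near [s = 0] both [v] and [v'] are bounded, so [Y] and [Y'] are [O(e^(m theta t))] and the
    energy has no positive part in the limit [t -> -oo]; being nonincreasing, it is never
    positive. *)
Lemma rad_sol_energy_nonpos (N : nat) (p gam T : R) (v v1 v2 : R -> R) :
  (3 <= N)%nat -> pS N < p -> 0 < T -> 1 <= gam -> rad_sol N p gam T v v1 v2 ->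
  forall t, t <= ln T / mconst N p ->
  energy (mconst N p) p (EF N p v) (EF1 N p v v1) t <= 0.
Proof.
intros HN Hp HT Hgam Hr t Ht.
assert (Hem := rad_sol_emden N p gam T v v1 v2 HN Hp HT Hr).
destruct (emden_constants N p HN Hp) as (Hp1 & Hth & HA & Hm & Hal & Hthp & Hm2 & HmA).
assert (Hle := rad_sol_le N p gam T v v1 v2 HN Hp1 Hgam Hr).
destruct Hr as (H0 & H1 & Hv).
destruct (Hv 0 ltac:(lra)) as (_ & D & _).
destruct (derivable_eps v1 0 _ 1 D Rlt_0_1) as (d & Hd & Hcont).
set (m := mconst N p) in *. set (th := theta p) in *. set (A := Aconst N p) in *.
set (K := gam / A + m * (th * gam + T) / A).
assert (Hthg : 0 < th * gam) by (apply Rmult_lt_0_compat; lra).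
assert (HmT : 0 < m * (th * gam + T)) by (apply Rmult_lt_0_compat; lra).
assert (HK : 0 < K).
{ unfold K. apply Rplus_lt_0_compat; apply Rdiv_lt_0_compat; lra. }
apply Rnot_lt_le. intros Hpos.
set (E0 := energy m p (EF N p v) (EF1 N p v v1) t) in *.
(* Once [Y] and [|Y'|] are at most [x <= 1], the energy at [t'] is at most
   [3 x / 2 <= 3 E0 / 4 < E0], against monotonicity. *)
set (x := Rmin 1 (E0 / 2)).
assert (Hx : 0 < x) by (apply Rmin_glb_lt; lra).
set (t' := Rmin t (Rmin (ln (d / 2) / m) (ln (x / K) / (m * th)))).
assert (Ht1 : t' <= t) by apply Rmin_l.
assert (Ht2 : t' <= ln (d / 2) / m) by (eapply Rle_trans; [apply Rmin_r | apply Rmin_l]).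
assert (Ht3 : t' <= ln (x / K) / (m * th)) by (eapply Rle_trans; [apply Rmin_r | apply Rmin_r]).
assert (Hdec := energy_decr m (alpha N p) p _ _ _ _ t' t Hm Hal Hp1 Hem (conj Ht1 Ht)).
assert (Hs1 : exp (m * t') <= d / 2) by (apply exp_le_of_le_ln; lra).
assert (HsT : exp (m * t') <= T) by (apply exp_le_of_le_ln; lra).
assert (HxK : 0 < x / K) by (apply Rdiv_lt_0_compat; lra).
assert (He : K * exp (m * th * t') <= x).
{ apply Rle_trans with (K * (x / K)); [|right; field; lra].
  apply Rmult_le_compat_l; [lra|]. apply exp_le_of_le_ln; [nra | assumption | assumption]. }
assert (Hs0 : 0 < exp (m * t')) by apply exp_pos.
assert (He0 : 0 < exp (m * th * t')) by apply exp_pos.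
destruct (Hv (exp (m * t')) ltac:(lra)) as (_ & _ & Hvpos & _).
assert (Hv1 : Rabs (v1 (exp (m * t'))) <= 1).
{ left. rewrite <- (Rminus_0_r (v1 _)), <- H1. apply Hcont.
  rewrite Rminus_0_r, Rabs_pos_eq; lra. }
assert (Hvle := Hle (exp (m * t')) ltac:(lra)).
destruct (Hem t' ltac:(lra)) as (_ & _ & HYpos & _).
assert (HY : EF N p v t' <= x).
{ eapply Rle_trans; [|exact He]. unfold EF. fold m th A.
  replace (exp (m * th * t') * v (exp (m * t')) / A)
    with (v (exp (m * t')) / A * exp (m * th * t')) by (field; lra).
  apply Rmult_le_compat_r; [lra|]. unfold K.
  assert (0 < m * (th * gam + T) / A) by (apply Rdiv_lt_0_compat; lra).
  assert (v (exp (m * t')) / A <= gam / A); [|lra].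
  apply Rmult_le_compat_r; [|lra]. left; now apply Rinv_0_lt_compat. }
assert (HY1 : Rabs (EF1 N p v v1 t') <= x).
{ eapply Rle_trans; [|exact He]. unfold EF1. fold m th A.
  replace (m * exp (m * th * t') * (th * v (exp (m * t')) + exp (m * t') * v1 (exp (m * t'))) / A)
    with ((m * / A * (th * v (exp (m * t')) + exp (m * t') * v1 (exp (m * t')))) * exp (m * th * t'))
    by (field; lra).
  rewrite Rabs_mult, (Rabs_pos_eq (exp (m * th * t'))) by lra.
  apply Rmult_le_compat_r; [lra|]. unfold K.
  assert (0 < gam / A) by (apply Rdiv_lt_0_compat; lra).
  assert (HiA : 0 < / A) by now apply Rinv_0_lt_compat.
  rewrite Rabs_mult, Rabs_pos_eq by nra.
  replace (m * (th * gam + T) / A) with (m * / A * (th * gam + T)) by (field; lra).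
  assert (Rabs (th * v (exp (m * t')) + exp (m * t') * v1 (exp (m * t'))) <= th * gam + T).
  { eapply Rle_trans; [apply Rabs_triang|].
    rewrite !Rabs_mult, (Rabs_pos_eq th), (Rabs_pos_eq (v _)), (Rabs_pos_eq (exp _)) by lra.
    nra. }
  assert (0 < m * / A) by now apply Rmult_lt_0_compat. nra. }
assert (Hx1 : x <= 1) by apply Rmin_l. assert (Hx2 : x <= E0 / 2) by apply Rmin_r.
fold E0 in Hdec. unfold energy, well in Hdec.
set (Y := EF N p v t') in *. set (Y1 := EF1 N p v v1 t') in *.
assert (HYp : Rpower Y p <= 1).
{ rewrite <- (Rpower_1_l p). apply Rle_Rpower_l; lra. }
assert (HYp0 := Rpower_pos Y p).
assert (Y * Rpower Y p / (p + 1) <= x).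
{ apply Rle_trans with (Y * Rpower Y p / 1).
  - apply Rmult_le_compat_l; [nra|]. apply Rinv_le_contravar; lra.
  - nra. }
assert (Y1 ^ 2 <= x ^ 2) by (rewrite <- (pow2_abs Y1); apply pow_incr; split; [apply Rabs_pos | lra]).
assert (x ^ 2 <= x) by nra.
assert (0 <= m ^ 2 * exp (2 * m * t') * Y ^ 2)
  by (apply Rmult_le_pos; [apply Rmult_le_pos; [apply pow2_ge_0 | left; apply exp_pos] | apply pow2_ge_0]).
assert (0 <= Y ^ 2) by apply pow2_ge_0.
lra.
Qed.

(** The natural length scale of a solution of height [gam]. The factor [Rmin 1 (theta p)] makes the
    core small enough for [theta v + s v' >= theta gam / 2]. *)
Definition core_radius (p gam : R) : R :=
  Rmin 1 (theta p) * Rpower gam (- ((p - 1) / 2)).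

Lemma core_radius_pos (p gam : R) : 1 < p -> 0 < core_radius p gam.
Proof.
intros Hp. apply Rmult_lt_0_compat; [|apply Rpower_pos].
apply Rmin_glb_lt; [lra | apply Rdiv_lt_0_compat; lra].
Qed.

Lemma core_radius_sq (p gam : R) : 1 < p -> 0 < gam ->
  Rpower gam p * core_radius p gam ^ 2 <= Rmin 1 (theta p) * gam.
Proof.
intros Hp Hg. unfold core_radius. set (c := Rmin 1 (theta p)).
assert (Hc : 0 < c) by (apply Rmin_glb_lt; [lra | apply Rdiv_lt_0_compat; lra]).
assert (Hc1 : c <= 1) by apply Rmin_l.
replace (Rpower gam p * (c * Rpower gam (- ((p - 1) / 2))) ^ 2)
  with (c * c * (Rpower gam p * (Rpower gam (- ((p - 1) / 2)) * Rpower gam (- ((p - 1) / 2)))))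
  by ring.
rewrite <- !Rpower_plus.
replace (p + (- ((p - 1) / 2) + - ((p - 1) / 2))) with 1 by field.
rewrite Rpower_1 by assumption. apply Rmult_le_compat_r; nra.
Qed.

Lemma core_radius_small (p x : R) : 1 < p -> 0 < x ->
  exists G, 1 <= G /\ forall gam, G <= gam -> core_radius p gam <= x.
Proof.
intros Hp Hx. exists (Rmax 1 (Rpower x (- (2 / (p - 1))))). split; [apply Rmax_l|].
intros gam Hg.
assert (Hg1 := Rle_trans _ _ _ (Rmax_l _ _) Hg).
assert (Hg2 := Rle_trans _ _ _ (Rmax_r _ _) Hg).
unfold core_radius. apply Rle_trans with (1 * Rpower gam (- ((p - 1) / 2))).
{ apply Rmult_le_compat_r; [left; apply Rpower_pos | apply Rmin_l]. }
rewrite Rmult_1_l, Rpower_Ropp. rewrite <- (Rinv_inv x).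
apply Rinv_le_contravar; [now apply Rinv_0_lt_compat|].
replace (/ x) with (Rpower (Rpower x (- (2 / (p - 1)))) ((p - 1) / 2)).
- apply Rle_Rpower_l; [lra | split; [apply Rpower_pos | assumption]].
- rewrite Rpower_mult. replace (- (2 / (p - 1)) * ((p - 1) / 2)) with (Ropp 1) by (field; lra).
  now rewrite Rpower_Ropp, Rpower_1.
Qed.

(* A lower bound for the slope of the Emden-Fowler transform on the unit
   interval of logarithmic time that ends at the core radius. *)
Definition core_slope (N : nat) (p : R) : R :=
  mconst N p * (theta p / 2) * exp (- (mconst N p * theta p)) *
    Rpower (Rmin 1 (theta p)) (theta p) / Aconst N p.

(** Friction loss over one unit of logarithmic time with slope at least [core_slope]; it does not
    involve [gamma]. *)
Definition energy_gap (N : nat) (p : R) : R := alpha N p * core_slope N p ^ 2.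

Lemma core_slope_pos (N : nat) (p : R) : (3 <= N)%nat -> pS N < p -> 0 < core_slope N p.
Proof.
intros HN Hp.
destruct (emden_constants N p HN Hp) as (Hp1 & Hth & HA & Hm & Hal & _).
apply Rdiv_lt_0_compat; [|assumption].
apply Rmult_lt_0_compat; [|apply Rpower_pos].
apply Rmult_lt_0_compat; [|apply exp_pos]. apply Rmult_lt_0_compat; lra.
Qed.

Lemma energy_gap_pos (N : nat) (p : R) : (3 <= N)%nat -> pS N < p -> 0 < energy_gap N p.
Proof.
intros HN Hp.
destruct (emden_constants N p HN Hp) as (Hp1 & Hth & HA & Hm & Hal & _).
apply Rmult_lt_0_compat; [assumption|]. apply pow_lt. now apply core_slope_pos.
Qed.

Lemma rad_sol_energy_gap (N : nat) (p gam T : R) (v v1 v2 : R -> R) :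
  (3 <= N)%nat -> pS N < p -> 1 <= gam -> core_radius p gam <= T ->
  rad_sol N p gam T v v1 v2 ->
  forall t, ln (core_radius p gam) / mconst N p <= t <= ln T / mconst N p ->
  energy (mconst N p) p (EF N p v) (EF1 N p v v1) t <= - energy_gap N p.
Proof.
intros HN Hp Hgam HT Hr t Ht.
destruct (emden_constants N p HN Hp) as (Hp1 & Hth & HA & Hm & Hal & Hthp & _).
assert (Hs0 := core_radius_pos p gam Hp1).
assert (Hem := rad_sol_emden N p gam T v v1 v2 HN Hp ltac:(lra) Hr).
set (tau := ln (core_radius p gam) / mconst N p) in *.
assert (HtauT : tau <= ln T / mconst N p) by lra.
apply Rle_trans with (energy (mconst N p) p (EF N p v) (EF1 N p v v1) tau).
{ apply (energy_decr _ _ _ _ _ _ _ tau t Hm Hal Hp1 Hem); lra. }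
assert (HE1 := rad_sol_energy_nonpos N p gam T v v1 v2 HN Hp ltac:(lra) Hgam Hr
  (tau - 1) ltac:(lra)).
destruct (MVT_cor2 _ _ (tau - 1) tau ltac:(lra)
  (fun t H => energy_deriv _ _ p _ _ _ _ t Hp1 Hem ltac:(lra))) as (xi & Hxi & Hxi').
set (s := exp (mconst N p * xi)).
assert (Hs : 0 < s) by apply exp_pos.
assert (Hss0 : s <= core_radius p gam) by (apply exp_le_of_le_ln; fold tau; lra).
destruct (rad_sol_core N p gam T v v1 v2 (Rmin 1 (theta p)) HN Hp1 Hgam Hr s ltac:(lra))
  as (Hv & Hv1).
{ eapply Rle_trans; [|apply (core_radius_sq p gam Hp1 ltac:(lra))].
  apply Rmult_le_compat_l; [left; apply Rpower_pos | apply pow_incr; lra]. }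
set (c := Rmin 1 (theta p)) in *.
assert (Hc : 0 < c) by (apply Rmin_glb_lt; lra).
assert (Hc1 : c <= 1) by apply Rmin_l. assert (Hc2 : c <= theta p) by apply Rmin_r.
assert (Hcore : gam * (theta p / 2) <= theta p * v s + s * v1 s).
{ assert (theta p * (gam * (1 - c / 6)) <= theta p * v s) by (apply Rmult_le_compat_l; lra).
  assert (c * (theta p * gam) <= 1 * (theta p * gam)) by (apply Rmult_le_compat_r; nra).
  assert (c * gam <= theta p * gam) by (apply Rmult_le_compat_r; lra). lra. }
(* The first factor is the loss from going back at most one unit of time from [tau]; the second is
   [s^theta] at the core radius, where [gam] appears to the power [-1] exactly. *)
assert (Hexp : exp (- (mconst N p * theta p)) * (Rpower c (theta p) / gam)
    <= exp (mconst N p * theta p * xi)).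
{ replace (Rpower c (theta p) / gam) with (Rpower (core_radius p gam) (theta p)).
  - unfold Rpower. rewrite <- exp_plus. apply exp_le_mono.
    replace (ln (core_radius p gam)) with (mconst N p * tau) by (unfold tau; field; lra).
    assert (0 < mconst N p * theta p) by now apply Rmult_lt_0_compat. nra.
  - unfold core_radius. fold c.
    rewrite <- Rpower_mult_distr by (assumption || apply Rpower_pos).
    rewrite Rpower_mult. replace (- ((p - 1) / 2) * theta p) with (Ropp 1) by lra.
    rewrite Rpower_Ropp, Rpower_1 by lra. reflexivity. }
assert (HY1 : core_slope N p <= EF1 N p v v1 xi).
{ unfold EF1, core_slope. fold s c. apply Rmult_le_compat_r; [left; now apply Rinv_0_lt_compat|].
  replace (mconst N p * (theta p / 2) * exp (- (mconst N p * theta p)) * Rpower c (theta p))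
    with (mconst N p * (exp (- (mconst N p * theta p)) * (Rpower c (theta p) / gam))
       * (gam * (theta p / 2))) by (field; lra).
  assert (0 < Rpower c (theta p) / gam) by (apply Rdiv_lt_0_compat; [apply Rpower_pos | lra]).
  assert (H0 := exp_pos (- (mconst N p * theta p))).
  apply Rmult_le_compat; [| nra | | exact Hcore].
  - apply Rmult_le_pos; [lra | apply Rmult_le_pos; lra].
  - apply Rmult_le_compat_l; lra. }
unfold energy_gap. assert (Hk := core_slope_pos N p HN Hp).
set (k := core_slope N p) in *.
replace (tau - (tau - 1)) with 1 in Hxi by ring.
assert (k ^ 2 <= EF1 N p v v1 xi ^ 2) by (apply pow_incr; lra).
assert (alpha N p * k ^ 2 <= alpha N p * EF1 N p v v1 xi ^ 2) by (apply Rmult_le_compat_l; lra).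
assert (0 <= mconst N p * (mconst N p ^ 2 * exp (2 * mconst N p * xi)) * EF N p v xi ^ 2).
{ apply Rmult_le_pos; [|apply pow2_ge_0].
  apply Rmult_le_pos; [lra|]. apply Rmult_le_pos; [apply pow2_ge_0 | left; apply exp_pos]. }
lra.
Qed.

(* Pohozaev's obstruction: a negative energy keeps the solution away from zero. *)
Lemma rad_sol_lower_bound (N : nat) (p S : R) : (3 <= N)%nat -> pS N < p -> 0 < S ->
  exists lo, 0 < lo < 1 /\ forall gam T v v1 v2, 1 <= gam -> T <= S ->
  rad_sol N p gam T v v1 v2 -> forall s, 0 <= s <= T -> lo <= v s.
Proof.
intros HN Hp HS.
destruct (emden_constants N p HN Hp) as (Hp1 & Hth & HA & Hm & Hal & Hthp & _).
set (h := mconst N p ^ 2 * exp (2 * mconst N p * (ln S / mconst N p))).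
assert (Hh : 0 < h) by apply (forcing_le _ _ _ Hm (Rle_refl _)).
assert (Heta := energy_gap_pos N p HN Hp).
set (r := energy_gap N p / (1 + h)).
assert (Hr0 : 0 < r) by (apply Rdiv_lt_0_compat; lra).
(* Capping at [1] gives [ymin^2 <= ymin <= r], so [r <= Y^2] yields [ymin <= Y] without a square
   root. *)
set (ymin := Rmin 1 r).
assert (Hy0 : 0 < ymin) by (apply Rmin_glb_lt; lra).
set (E := exp (mconst N p * theta p * (ln S / mconst N p))).
assert (HE : 0 < E) by apply exp_pos.
set (lo := Rmin (1 / 2) (Aconst N p * ymin / E)).
assert (Hlo : 0 < lo).
{ apply Rmin_glb_lt; [lra|]. apply Rdiv_lt_0_compat; [|assumption].
  now apply Rmult_lt_0_compat. }
assert (Hlo1 : lo <= 1 / 2) by apply Rmin_l.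
exists lo. split; [lra|].
intros gam T v v1 v2 Hgam HTS Hr s Hs.
assert (Hs0 := core_radius_pos p gam Hp1).
(* Inside the core [v >= 5 gam / 6 >= lo]; outside it the energy gap applies. *)
destruct (Rle_lt_dec s (core_radius p gam)) as [Hsr | Hsr].
- destruct (rad_sol_core N p gam T v v1 v2 (Rmin 1 (theta p)) HN Hp1 Hgam Hr s Hs)
    as (Hv & _).
  { eapply Rle_trans; [|apply (core_radius_sq p gam Hp1 ltac:(lra))].
    apply Rmult_le_compat_l; [left; apply Rpower_pos | apply pow_incr; lra]. }
  assert (Rmin 1 (theta p) <= 1) by apply Rmin_l. nra.
- set (t := ln s / mconst N p).
  assert (Hln : forall a b, 0 < a -> a <= b -> ln a / mconst N p <= ln b / mconst N p).
  { intros a b Ha Hab. apply Rmult_le_compat_r; [left; now apply Rinv_0_lt_compat|].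
    apply ln_le; lra. }
  assert (HtT : t <= ln T / mconst N p) by (apply Hln; lra).
  assert (HtS : t <= ln S / mconst N p) by (apply Hln; lra).
  assert (Hgap := rad_sol_energy_gap N p gam T v v1 v2 HN Hp Hgam ltac:(lra) Hr t
    (conj (Hln _ _ Hs0 (Rlt_le _ _ Hsr)) HtT)).
  destruct (rad_sol_emden N p gam T v v1 v2 HN Hp ltac:(lra) Hr t HtT) as (_ & _ & HY & _).
  unfold energy, well in Hgap.
  destruct (forcing_le _ _ _ Hm HtS) as [h0 h1]. fold h in h1.
  assert (Hes : exp (mconst N p * t) = s).
  { unfold t. replace (mconst N p * (ln s / mconst N p)) with (ln s) by (field; lra).
    apply exp_ln. lra. }
  assert (HYv : Aconst N p * EF N p v t / exp (mconst N p * theta p * t) = v s).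
  { unfold EF. rewrite Hes. assert (H := exp_pos (mconst N p * theta p * t)). field. lra. }
  set (Y := EF N p v t) in *.
  assert (0 < Y * Rpower Y p / (p + 1)).
  { apply Rdiv_lt_0_compat; [|lra]. apply Rmult_lt_0_compat; [lra|apply Rpower_pos]. }
  assert (0 <= EF1 N p v v1 t ^ 2) by apply pow2_ge_0.
  assert (HY2 : r <= Y ^ 2).
  { apply Rmult_le_reg_r with (1 + h); [lra|].
    replace (r * (1 + h)) with (energy_gap N p) by (unfold r; field; lra).
    assert (mconst N p ^ 2 * exp (2 * mconst N p * t) * Y ^ 2 <= h * Y ^ 2)
      by (apply Rmult_le_compat_r; [apply pow2_ge_0 | lra]).
    lra. }
  assert (HYmin : ymin <= Y).
  { apply Rnot_lt_le. intros Hc.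
    assert (ymin <= 1) by apply Rmin_l. assert (ymin <= r) by apply Rmin_r. nra. }
  rewrite <- HYv.
  apply Rle_trans with (Aconst N p * ymin / E); [apply Rmin_r|].
  assert (H1 : exp (mconst N p * theta p * t) <= E).
  { apply exp_le_mono. apply Rmult_le_compat_l; [|assumption].
    left; now apply Rmult_lt_0_compat. }
  apply Rmult_le_compat.
  + left; now apply Rmult_lt_0_compat.
  + left; now apply Rinv_0_lt_compat.
  + apply Rmult_le_compat_l; lra.
  + apply Rinv_le_contravar; [apply exp_pos | assumption].
Qed.

(** * The radial initial value problem *)

(* At [s = 0] the quotient is [0 / 0 = 0], the correct value of the flux. *)
Definition flux (n : nat) (w : R -> R) (s : R) : R :=
  RInt (fun t => t ^ n * w t) 0 s / s ^ n.

Definition radial_int (n : nat) (w : R -> R) (s : R) : R := RInt (flux n w) 0 s.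

Lemma RInt_0_0 (f : R -> R) : RInt f 0 0 = 0.
Proof. rewrite RInt_point. reflexivity. Qed.

Lemma continuous_pow_mul (n : nat) (w : R -> R) (x : R) :
  continuous w x -> continuous (fun t => t ^ n * w t) x.
Proof.
intros Hw. apply continuity_pt_filterlim. apply (continuity_pt_mult (fun t => t ^ n) w).
- apply derivable_continuous_pt, derivable_pt_pow.
- now apply continuity_pt_filterlim.
Qed.

Lemma RInt_0_derive (f : R -> R) (s : R) :
  (forall x, continuous f x) -> is_derive (fun s => RInt f 0 s) s (f s).
Proof.
intros Hf. apply (is_derive_RInt f _ 0); [|apply Hf].
apply filter_forall. intros x. apply (RInt_correct (V := R_CompleteNormedModule)).
apply (ex_RInt_continuous (V := R_CompleteNormedModule)). intros; apply Hf.
Qed.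

Lemma ex_RInt_cont (f : R -> R) (a b : R) : (forall x, continuous f x) -> ex_RInt f a b.
Proof. intros Hf. apply (ex_RInt_continuous (V := R_CompleteNormedModule)). intros; apply Hf. Qed.

Lemma flux_0 (n : nat) (w : R -> R) : flux n w 0 = 0.
Proof. unfold flux. rewrite RInt_0_0. apply Rmult_0_l. Qed.

Lemma flux_deriv (n : nat) (w : R -> R) (s : R) :
  (forall x, continuous w x) -> s <> 0 ->
  is_derive (flux n w) s (w s - INR n / s * flux n w s).
Proof.
intros Hw Hs. unfold flux.
assert (D := RInt_0_derive (fun t => t ^ n * w t) s
  (fun x => continuous_pow_mul n w x (Hw x))). cbv beta in D.
set (I := fun s => RInt (fun t => t ^ n * w t) 0 s) in *.
change (is_derive (fun s => I s / s ^ n) s (w s - INR n / s * (I s / s ^ n))).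
assert (Hsn : s ^ n <> 0) by now apply pow_nonzero.
auto_derive.
- split; [eexists; exact D | split; auto].
- rewrite_derives. destruct n as [|n].
  + simpl. field. lra.
  + rewrite S_INR. simpl in *. field. split; [apply pow_nonzero|]; assumption.
Qed.

(** [rad_sol] asks for [v''] at the origin too. Comparing the integral with [w 0 * s^(n+1)/(n+1)] by
    the mean value theorem, the error in the quotient is [(c/h)^n (w c - w 0)] with [|c| <= |h|]. *)
Lemma flux_deriv_0 (n : nat) (w : R -> R) :
  (forall x, continuous w x) -> is_derive (flux n w) 0 (w 0 / (INR n + 1)).
Proof.
intros Hw. apply is_derive_Reals. intros eps Heps.
assert (Hc : continuity_pt w 0) by (apply continuity_pt_filterlim, Hw).
destruct (Hc (eps / 2) ltac:(lra)) as (d & Hd & Hcd).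
exists (mkposreal d Hd). intros h Hh Hhd. simpl in Hhd.
rewrite Rplus_0_l, flux_0, Rminus_0_r. unfold flux.
assert (Hn : 0 < INR n + 1) by (assert (H := pos_INR n); lra).
set (I := fun s => RInt (fun t => t ^ n * w t) 0 s).
destruct (MVT_gen (fun s => I s - w 0 * s ^ S n / (INR n + 1)) 0 h
  (fun s => s ^ n * (w s - w 0))) as (c & Hc1 & Hc2).
{ intros x _. unfold I.
  replace (x ^ n * (w x - w 0)) with (x ^ n * w x - w 0 * x ^ n) by ring.
  apply (is_derive_minus (V := R_NormedModule)).
  - apply (RInt_0_derive (fun t => t ^ n * w t) x
      (fun x => continuous_pow_mul n w x (Hw x))).
  - auto_derive; [exact Logic.I|].
    change (match n with 0%nat => 1 | S _ => INR n + 1 end) with (INR (S n)).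
    rewrite S_INR. field. lra. }
{ intros x _. apply continuity_pt_minus.
  - apply derivable_continuous_pt. eexists. apply is_derive_Reals.
    apply (RInt_0_derive (fun t => t ^ n * w t) x
      (fun x => continuous_pow_mul n w x (Hw x))).
  - apply derivable_continuous_pt. eexists. apply is_derive_Reals.
    auto_derive; [exact Logic.I | reflexivity]. }
assert (HI0 : I 0 = 0) by apply RInt_0_0.
rewrite HI0 in Hc2. rewrite (pow_ne_zero (S n)) in Hc2 by lia.
fold (I h).
assert (Hhn : h ^ n <> 0) by now apply pow_nonzero.
assert (Hch : Rabs c <= Rabs h).
{ revert Hc1. unfold Rmin, Rmax, Rabs. destruct (Rle_dec 0 h), (Rcase_abs c), (Rcase_abs h); lra. }
assert (Hwc : Rabs (w c - w 0) < eps).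
{ destruct (Req_dec c 0) as [->|Hc0]; [rewrite Rminus_diag, Rabs_R0; lra|].
  assert (Rabs (w c - w 0) < eps / 2); [|lra].
  apply Hcd. split; [split; [exact Logic.I | congruence]|].
  simpl. unfold Rdist. rewrite Rminus_0_r. lra. }
replace (I h / h ^ n / h - w 0 / (INR n + 1)) with ((c / h) ^ n * (w c - w 0)).
- rewrite Rabs_mult, <- RPow_abs.
  assert (Rabs (c / h) ^ n <= 1).
  { rewrite <- (pow1 n). apply pow_incr. split; [apply Rabs_pos|].
    unfold Rdiv. rewrite Rabs_mult, Rabs_inv.
    assert (0 < Rabs h) by now apply Rabs_pos_lt.
    apply Rmult_le_reg_r with (Rabs h); [assumption|].
    rewrite Rmult_assoc, Rinv_l by lra. lra. }
  assert (0 <= Rabs (c / h) ^ n) by apply pow_le, Rabs_pos.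
  assert (0 <= Rabs (w c - w 0)) by apply Rabs_pos. nra.
- replace ((c / h) ^ n) with (c ^ n / h ^ n)
    by (unfold Rdiv; rewrite Rpow_mult_distr, pow_inv; reflexivity).
  simpl in Hc2.
  replace (I h) with (c ^ n * (w c - w 0) * h + w 0 * (h * h ^ n) / (INR n + 1)) by lra.
  field. repeat split; assumption || lra.
Qed.

Lemma flux_continuous (n : nat) (w : R -> R) (s : R) :
  (forall x, continuous w x) -> continuous (flux n w) s.
Proof.
intros Hw. apply (ex_derive_continuous (flux n w)).
destruct (Req_dec s 0) as [-> | Hs]; eexists;
  [now apply flux_deriv_0 | now apply flux_deriv].
Qed.

Lemma radial_int_deriv (n : nat) (w : R -> R) (s : R) :
  (forall x, continuous w x) -> is_derive (radial_int n w) s (flux n w s).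
Proof.
intros Hw. apply (RInt_0_derive (flux n w)). intros x. now apply flux_continuous.
Qed.

Lemma radial_int_0 (n : nat) (w : R -> R) : radial_int n w 0 = 0.
Proof. apply RInt_0_0. Qed.

Lemma radial_int_minus (n : nat) (w w' : R -> R) (s : R) :
  (forall x, continuous w x) -> (forall x, continuous w' x) ->
  radial_int n w s - radial_int n w' s = radial_int n (fun t => w t - w' t) s.
Proof.
intros Hw Hw'. unfold radial_int.
rewrite <- (RInt_minus (V := R_CompleteNormedModule)) by
  (apply ex_RInt_cont; intros; now apply flux_continuous).
apply RInt_ext. intros x _. unfold flux, minus, plus, opp; simpl.
assert (E : RInt (fun t => t ^ n * w t) 0 x - RInt (fun t => t ^ n * w' t) 0 x
   = RInt (fun t => t ^ n * (w t - w' t)) 0 x).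
{ rewrite <- (RInt_minus (V := R_CompleteNormedModule)) by
    (apply ex_RInt_cont; intros; now apply continuous_pow_mul).
  apply RInt_ext. intros y _. unfold minus, plus, opp; simpl. ring. }
rewrite <- E. unfold Rdiv. ring.
Qed.

Lemma RInt_exp_bound (f : R -> R) (D K s : R) :
  0 < K -> 0 <= D -> 0 <= s -> (forall x, continuous f x) ->
  (forall t, 0 < t <= s -> Rabs (f t) <= D * exp (K * t)) ->
  Rabs (RInt f 0 s) <= D * exp (K * s) / K.
Proof.
intros HK HD Hs Hf Hb.
assert (HI : is_RInt (fun t => D * exp (K * t)) 0 s (D * exp (K * s) / K - D / K)).
{ replace (D / K) with (D * exp (K * 0) / K) by (rewrite Rmult_0_r, exp_0; field; lra).
  apply (is_RInt_derive (fun t => D * exp (K * t) / K)).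
  - intros x _. auto_derive; [exact I | field; lra].
  - intros x _. apply (ex_derive_continuous (fun t => D * exp (K * t))). auto_derive. exact I. }
assert (HD0 : 0 <= D / K) by (apply Rdiv_le_0_compat; lra).
apply Rle_trans with (D * exp (K * s) / K - D / K); [|lra].
rewrite <- (is_RInt_unique _ _ _ _ HI).
eapply Rle_trans; [apply abs_RInt_le; [assumption | now apply ex_RInt_cont]|].
apply RInt_le; [assumption| |eexists; exact HI|].
- apply ex_RInt_cont. intros x. apply (continuous_comp f Rabs); [apply Hf | apply continuous_Rabs].
- intros x Hx. apply Hb. lra.
Qed.

(** An exponentially weighted norm: each of the two integrations gains [1/K], and the weights [t^n]
    cost nothing since [r <= t]. For large [K] the Picard map contracts on the whole half line at
    once. *)
Lemma radial_int_bound (n : nat) (w : R -> R) (D K s : R) :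
  0 < K -> 0 <= D -> 0 <= s -> (forall x, continuous w x) ->
  (forall t, 0 <= t <= s -> Rabs (w t) <= D * exp (K * t)) ->
  Rabs (radial_int n w s) <= D * exp (K * s) / K ^ 2.
Proof.
intros HK HD Hs Hw Hb.
replace (D * exp (K * s) / K ^ 2) with (D / K * exp (K * s) / K) by (field; lra).
apply RInt_exp_bound; [assumption|apply Rdiv_le_0_compat; lra|assumption| |].
- intros x. now apply flux_continuous.
- intros t Ht. unfold flux. assert (Htn : 0 < t ^ n) by (apply pow_lt; lra).
  unfold Rdiv. rewrite Rabs_mult, Rabs_inv, (Rabs_pos_eq (t ^ n)) by lra.
  apply Rmult_le_reg_r with (t ^ n); [assumption|].
  rewrite Rmult_assoc, Rinv_l, Rmult_1_r by lra.
  replace (D * / K * exp (K * t) * t ^ n) with ((t ^ n * D) * exp (K * t) / K) by (field; lra).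
  apply RInt_exp_bound; [assumption|nra|lra| |].
  + intros x. now apply continuous_pow_mul.
  + intros r Hr. rewrite Rabs_mult, Rmult_assoc.
    apply Rmult_le_compat; [apply Rabs_pos|apply Rabs_pos| |apply Hb; lra].
    rewrite Rabs_pos_eq by (apply pow_le; lra). apply pow_incr. lra.
Qed.

Lemma Lim_seq_geom_bound (a : nat -> R) (C : R) :
  (forall k, Rabs (a (S k) - a k) <= C * (1 / 2) ^ k) ->
  forall k, Rabs (real (Lim_seq a) - a k) <= 2 * C * (1 / 2) ^ k.
Proof.
intros H.
assert (HC : 0 <= C).
{ specialize (H 0%nat). simpl in H. assert (H0 := Rabs_pos (a 1%nat - a 0%nat)). lra. }
assert (Hpos : forall k, 0 < (1 / 2) ^ k) by (intros; apply pow_lt; lra).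
assert (Hd : forall k j, Rabs (a (k + j)%nat - a k) <= 2 * C * (1 / 2) ^ k).
{ intros k j.
  assert (Rabs (a (k + j)%nat - a k) <= 2 * C * ((1 / 2) ^ k - (1 / 2) ^ (k + j))).
  { induction j as [|j IH].
    - rewrite Nat.add_0_r, !Rminus_diag, Rabs_R0. lra.
    - rewrite Nat.add_succ_r. specialize (H (k + j)%nat).
      replace (a (S (k + j)) - a k) with ((a (S (k + j)) - a (k + j)%nat) + (a (k + j)%nat - a k))
        by ring.
      eapply Rle_trans; [apply Rabs_triang|]. simpl. lra. }
  assert (0 < (1 / 2) ^ (k + j)) by apply Hpos. nra. }
assert (Hlim : exists l, is_lim_seq a l /\ forall k, Rabs (l - a k) <= 2 * C * (1 / 2) ^ k).
{ destruct (Rcomplete.R_complete a) as (l & Hl).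
  - intros eps Heps.
    destruct (pow_lt_1_zero (1 / 2)) with (y := eps / (4 * C + 4)) as (K & HK).
    + rewrite Rabs_pos_eq; lra.
    + apply Rdiv_lt_0_compat; lra.
    + exists K. intros i j Hi Hj. specialize (HK K (le_n K)).
      rewrite Rabs_pos_eq in HK by (left; apply Hpos).
      assert (H1 := Hd K (i - K)%nat). assert (H2 := Hd K (j - K)%nat).
      replace (K + (i - K))%nat with i in H1 by lia.
      replace (K + (j - K))%nat with j in H2 by lia.
      unfold Rdist. replace (a i - a j) with ((a i - a K) - (a j - a K)) by ring.
      eapply Rle_lt_trans; [apply Rabs_triang|]. rewrite Rabs_Ropp.
      assert (HK' : (1 / 2) ^ K * (4 * C + 4) < eps).
      { apply Rlt_le_trans with (eps / (4 * C + 4) * (4 * C + 4)); [|right; field; lra].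
        apply Rmult_lt_compat_r; lra. }
      assert (0 < (1 / 2) ^ K) by apply Hpos. lra.
  - exists l. split; [now apply is_lim_seq_Reals|].
    intros k. apply Rnot_lt_le. intros Hc.
    destruct (Hl (Rabs (l - a k) - 2 * C * (1 / 2) ^ k)) as (M & HM);
      [now apply Rlt_0_minus|].
    specialize (HM (k + M)%nat ltac:(lia)). unfold Rdist in HM.
    assert (H1 := Hd k M).
    assert (Rabs (l - a k) <= Rabs (a (k + M)%nat - l) + Rabs (a (k + M)%nat - a k)); [|lra].
    rewrite (Rabs_minus_sym (a (k + M)%nat) l).
    replace (l - a k) with ((l - a (k + M)%nat) + (a (k + M)%nat - a k)) by ring.
    apply Rabs_triang. }
destruct Hlim as (l & Hl & Hb). rewrite (is_lim_seq_unique _ _ Hl). exact Hb.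
Qed.

(* Precomposition with [Rabs] makes the scheme on the half line insensitive to
   negative arguments, while the limit stays two-sided differentiable at 0. *)
Fixpoint picard (n : nat) (g : R -> R) (gam : R) (k : nat) (s : R) : R :=
  match k with
  | O => gam
  | S k => gam - radial_int n (fun t => g (picard n g gam k (Rabs t))) s
  end.

Lemma lipschitz_continuous (g : R -> R) (L : R) :
  (forall x y, Rabs (g x - g y) <= L * Rabs (x - y)) -> forall x, continuous g x.
Proof.
intros HL x. apply continuity_pt_filterlim. intros eps Heps.
assert (HL0 : 0 <= L).
{ assert (H := HL 1 0). rewrite Rminus_0_r, Rabs_R1 in H.
  assert (H0 := Rabs_pos (g 1 - g 0)). lra. }
exists (eps / (L + 1)). split; [apply Rdiv_lt_0_compat; lra|].
intros z (_ & Hz). simpl in *. unfold Rdist in *.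
eapply Rle_lt_trans; [apply HL|].
apply Rle_lt_trans with (L * (eps / (L + 1))); [apply Rmult_le_compat_l; lra|].
apply Rlt_le_trans with ((L + 1) * (eps / (L + 1))); [|right; field; lra].
apply Rmult_lt_compat_r; [apply Rdiv_lt_0_compat; lra | lra].
Qed.

Lemma radial_ivp (n : nat) (g : R -> R) (L gam : R) :
  (forall x y, Rabs (g x - g y) <= L * Rabs (x - y)) ->
  exists v v1 v2 : R -> R, v 0 = gam /\ v1 0 = 0 /\
  forall s, derivable_pt_lim v s (v1 s) /\ derivable_pt_lim v1 s (v2 s) /\
    (0 < s -> v2 s + INR n / s * v1 s + g (v s) = 0).
Proof.
intros HL. assert (Hg := lipschitz_continuous g L HL).
assert (HL0 : 0 <= L).
{ assert (H := HL 1 0). rewrite Rminus_0_r, Rabs_R1 in H.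
  assert (H0 := Rabs_pos (g 1 - g 0)). lra. }
set (u := picard n g gam).
assert (Hu : forall k x, continuous (u k) x).
{ induction k as [|k IH]; intros x; simpl.
  - apply continuous_const.
  - apply (continuous_minus (V := R_NormedModule)); [apply continuous_const|].
    apply (ex_derive_continuous (radial_int n (fun t => g (u k (Rabs t))))).
    eexists. apply radial_int_deriv. intros y.
    apply (continuous_comp (fun t => u k (Rabs t)) g); [|apply Hg].
    apply (continuous_comp Rabs (u k)); [apply continuous_Rabs | apply IH]. }
assert (Hgu : forall k x, continuous (fun t => g (u k (Rabs t))) x).
{ intros k y. apply (continuous_comp (fun t => u k (Rabs t)) g); [|apply Hg].
  apply (continuous_comp Rabs (u k)); [apply continuous_Rabs | apply Hu]. }
(* Chosen to make the contraction factor [L / K^2] at most [1/2]. *)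
set (K := 1 + 2 * L). assert (HK : 1 <= K) by (unfold K; lra).
assert (HLK : L / K ^ 2 <= 1 / 2).
{ apply Rmult_le_reg_r with (K ^ 2); [nra|].
  replace (L / K ^ 2 * K ^ 2) with L by (field; lra). unfold K; nra. }
set (D := Rabs (g gam)). assert (HD : 0 <= D) by apply Rabs_pos.
assert (Hstep : forall k s, 0 <= s ->
  Rabs (u (S k) s - u k s) <= D * exp (K * s) * (1 / 2) ^ k).
{ induction k as [|k IH]; intros s Hs.
  - change (Rabs (gam - radial_int n (fun _ => g gam) s - gam) <= D * exp (K * s) * 1).
    replace (gam - radial_int n (fun _ => g gam) s - gam)
      with (- radial_int n (fun _ => g gam) s) by ring.
    rewrite Rabs_Ropp, Rmult_1_r.
    apply Rle_trans with (D * exp (K * s) / K ^ 2).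
    + apply radial_int_bound; [lra|assumption|assumption|intros; apply continuous_const|].
      intros t Ht. fold D. assert (1 <= exp (K * t)) by (rewrite <- exp_0; apply exp_le_mono; nra).
      nra.
    + assert (0 <= D * exp (K * s)) by (apply Rmult_le_pos; [assumption | left; apply exp_pos]).
      assert (/ K ^ 2 <= 1) by (rewrite <- Rinv_1; apply Rinv_le_contravar; nra).
      unfold Rdiv. nra.
  - change (Rabs ((gam - radial_int n (fun t => g (u (S k) (Rabs t))) s)
      - (gam - radial_int n (fun t => g (u k (Rabs t))) s)) <= D * exp (K * s) * (1 / 2) ^ S k).
    replace (_ - _ - (_ - _)) with
      (- (radial_int n (fun t => g (u (S k) (Rabs t))) s
         - radial_int n (fun t => g (u k (Rabs t))) s)) by ring.
    rewrite Rabs_Ropp, radial_int_minus by apply Hgu.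
    assert (Hk : 0 < (1 / 2) ^ k) by (apply pow_lt; lra).
    assert (0 <= D * exp (K * s)) by (apply Rmult_le_pos; [assumption | left; apply exp_pos]).
    apply Rle_trans with (L * (D * (1 / 2) ^ k) * exp (K * s) / K ^ 2).
    + apply radial_int_bound; [lra| |assumption| |].
      * apply Rmult_le_pos; [assumption | nra].
      * intros x. apply (continuous_minus (V := R_NormedModule)); apply Hgu.
      * intros t Ht. eapply Rle_trans; [apply HL|].
        rewrite (Rabs_pos_eq t) by lra.
        rewrite !Rmult_assoc. apply Rmult_le_compat_l; [assumption|].
        eapply Rle_trans; [apply IH; lra | right; ring].
    + replace (L * (D * (1 / 2) ^ k) * exp (K * s) / K ^ 2)
        with (L / K ^ 2 * (D * exp (K * s) * (1 / 2) ^ k)) by (field; lra).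
      simpl.
      replace (D * exp (K * s) * (1 / 2 * (1 / 2) ^ k))
        with (1 / 2 * (D * exp (K * s) * (1 / 2) ^ k)) by ring.
      apply Rmult_le_compat_r; [nra | assumption]. }
set (U := fun s => real (Lim_seq (fun k => u k (Rabs s)))).
assert (HU : forall k s, Rabs (U s - u k (Rabs s)) <= 2 * (D * exp (K * Rabs s)) * (1 / 2) ^ k).
{ intros k s. apply (Lim_seq_geom_bound (fun k => u k (Rabs s))).
  intros j. apply Hstep, Rabs_pos. }
assert (Hsmall : forall B eps, 0 <= B -> 0 < eps -> exists k, B * (1 / 2) ^ k < eps).
{ intros B eps HB Heps. destruct (pow_lt_1_zero (1 / 2)) with (y := eps / (B + 1)) as (k & Hk).
  - rewrite Rabs_pos_eq; lra.
  - apply Rdiv_lt_0_compat; lra.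
  - exists k. specialize (Hk k (le_n k)).
    assert (H0 : 0 < (1 / 2) ^ k) by (apply pow_lt; lra).
    rewrite Rabs_pos_eq in Hk by lra.
    apply Rlt_le_trans with (eps / (B + 1) * (B + 1)); [|right; field; lra]. nra. }
assert (HUc : forall x, continuous U x).
{ intros x. apply continuity_pt_filterlim. intros eps Heps.
  set (B := 2 * (D * exp (K * (Rabs x + 1)))).
  assert (HB : 0 <= B).
  { unfold B. assert (H := exp_pos (K * (Rabs x + 1))). nra. }
  destruct (Hsmall B (eps / 3) HB ltac:(lra)) as (k & Hk).
  assert (Hck : continuity_pt (fun t => u k (Rabs t)) x).
  { apply continuity_pt_filterlim.
    apply (continuous_comp Rabs (u k)); [apply continuous_Rabs | apply Hu]. }
  destruct (Hck (eps / 3) ltac:(lra)) as (d & Hd & Hcd).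
  exists (Rmin 1 d). split; [apply Rmin_glb_lt; lra|].
  intros z (Hz1 & Hz). simpl in *. unfold Rdist in *.
  assert (Hzd := Rlt_le_trans _ _ _ Hz (Rmin_r _ _)).
  assert (Hz1' := Rlt_le_trans _ _ _ Hz (Rmin_l _ _)).
  specialize (Hcd z (conj Hz1 Hzd)).
  assert (Hbd : forall r, Rabs r <= Rabs x + 1 -> Rabs (U r - u k (Rabs r)) < eps / 3).
  { intros r Hr. eapply Rle_lt_trans; [apply HU|]. eapply Rle_lt_trans; [|apply Hk].
    apply Rmult_le_compat_r; [apply pow_le; lra|]. unfold B.
    apply Rmult_le_compat_l; [lra|]. apply Rmult_le_compat_l; [assumption|].
    apply exp_le_mono. nra. }
  assert (H1 := Hbd x ltac:(lra)).
  assert (Hzx : Rabs z <= Rabs x + 1).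
  { assert (H := Rabs_triang_inv z x). lra. }
  assert (H2 := Hbd z Hzx).
  replace (U z - U x) with ((U z - u k (Rabs z)) + (u k (Rabs z) - u k (Rabs x))
    + - (U x - u k (Rabs x))) by ring.
  eapply Rle_lt_trans; [apply Rabs_triang|]. rewrite Rabs_Ropp.
  eapply Rle_lt_trans; [apply Rplus_le_compat_r, Rabs_triang|]. lra. }
set (w := fun t => g (U t)).
assert (Hw : forall x, continuous w x).
{ intros x. apply (continuous_comp U g); [apply HUc | apply Hg]. }
(* The limit [U] is only known to be continuous; [v] is differentiable by construction, and their
   agreement for [s >= 0] gives the equation. *)
set (v := fun s => gam - radial_int n w s).
assert (Hfix : forall s, 0 <= s -> v s = U s).
{ intros s Hs. apply Rminus_diag_uniq. apply Rabs_eq_0.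
  apply Rle_antisym; [|apply Rabs_pos]. apply Rnot_lt_le. intros Hc.
  set (B := 2 * (D * exp (K * s))).
  assert (HB : 0 <= B) by (unfold B; assert (H := exp_pos (K * s)); nra).
  destruct (Hsmall B _ HB Hc) as (k & Hk).
  apply Rlt_not_le in Hk. apply Hk.
  replace (v s - U s) with (- (radial_int n w s - radial_int n (fun t => g (u k (Rabs t))) s)
    + - (U s - u (S k) s)) 
    by (change (u (S k) s) with (gam - radial_int n (fun t => g (u k (Rabs t))) s);
        unfold v; ring).
  eapply Rle_trans; [apply Rabs_triang|]. rewrite !Rabs_Ropp.
  assert (H1 := HU (S k) s). rewrite (Rabs_pos_eq s Hs) in H1. fold B in H1.
  rewrite radial_int_minus by (exact Hw || apply Hgu).
  assert (Hk0 : 0 < (1 / 2) ^ k) by (apply pow_lt; lra).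
  assert (H2 : Rabs (radial_int n (fun t => w t - g (u k (Rabs t))) s)
     <= L * (2 * D * (1 / 2) ^ k) * exp (K * s) / K ^ 2).
  { apply radial_int_bound; [lra| |assumption| |].
    - apply Rmult_le_pos; [assumption | nra].
    - intros x. apply (continuous_minus (V := R_NormedModule)); [apply Hw | apply Hgu].
    - intros t Ht. unfold w. eapply Rle_trans; [apply HL|].
      rewrite !Rmult_assoc. apply Rmult_le_compat_l; [assumption|].
      eapply Rle_trans; [apply HU|]. rewrite (Rabs_pos_eq t) by lra. right; ring. }
  replace (L * (2 * D * (1 / 2) ^ k) * exp (K * s) / K ^ 2)
    with (L / K ^ 2 * (B * (1 / 2) ^ k)) in H2 by (unfold B; field; lra).
  assert (L / K ^ 2 * (B * (1 / 2) ^ k) <= 1 / 2 * (B * (1 / 2) ^ k)).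
  { apply Rmult_le_compat_r; [nra | assumption]. }
  simpl in H1. lra. }
(* At [s = 0] the general formula would evaluate to [- w 0], because the flux vanishes there; the
   true derivative is [- w 0 / (n + 1)]. *)
exists v, (fun s => - flux n w s),
  (fun s => if Req_dec_T s 0 then - (w 0 / (INR n + 1)) else - (w s - INR n / s * flux n w s)).
split; [unfold v; rewrite radial_int_0; ring|].
split; [rewrite flux_0; ring|].
intros s. split; [|split].
- apply is_derive_Reals. unfold v.
  replace (- flux n w s) with (0 - flux n w s) by ring.
  apply (is_derive_minus (V := R_NormedModule));
    [apply (is_derive_const (V := R_NormedModule)) | now apply radial_int_deriv].
- apply is_derive_Reals.
  destruct (Req_dec_T s 0) as [-> | Hs]; apply (is_derive_opp (V := R_NormedModule));
    [now apply flux_deriv_0 | now apply flux_deriv].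
- intros Hs. destruct (Req_dec_T s 0) as [-> | _]; [lra|].
  rewrite (Hfix s) by lra. unfold w. lra.
Qed.

(** * Positive solutions and convergence *)

(** Bootstrap: a weak bound on [[0, s]] that improves itself to a strict one at [s] can never be
    lost. The supremum of the radii reached satisfies the strict bound, hence by continuity can only
    be the end point. *)
Lemma continuous_induction_gt (f : R -> R) (a S : R) :
  (forall x, 0 <= x <= S -> continuity_pt f x) -> a < f 0 ->
  (forall s, 0 <= s <= S -> (forall r, 0 <= r <= s -> a <= f r) -> a < f s) ->
  forall s, 0 <= s <= S -> a < f s.
Proof.
intros Hc H0 Hind s Hs. apply Rnot_le_lt. intros Hle.
set (E := fun r => 0 <= r <= s /\ forall q, 0 <= q <= r -> a <= f q).
destruct (completeness E) as (m & Hub & Hlub).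
{ exists s. intros r (Hr & _). lra. }
{ exists 0. split; [lra|]. intros q Hq. replace q with 0 by lra. lra. }
assert (Hm0 : 0 <= m).
{ apply Hub. split; [lra|]. intros q Hq. replace q with 0 by lra. lra. }
assert (Hms : m <= s) by (apply Hlub; intros r (Hr & _); lra).
assert (Hbelow : forall q, 0 <= q < m -> a <= f q).
{ intros q Hq. apply Rnot_lt_le. intros Hlt.
  assert (m <= q); [|lra]. apply Hlub. intros r (Hr & Hrq). apply Rnot_lt_le. intros Hqr.
  specialize (Hrq q ltac:(lra)). lra. }
assert (Hcm : forall eps, 0 < eps -> exists d, 0 < d /\
   forall z, Rabs (z - m) < d -> Rabs (f z - f m) < eps).
{ intros eps. apply continuity_pt_eps, Hc. lra. }
assert (Hfm : a <= f m).
{ apply Rnot_lt_le. intros Hlt.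
  destruct (Rle_lt_or_eq_dec 0 m Hm0) as [Hm | <-]; [|lra].
  destruct (Hcm (a - f m) ltac:(lra)) as (d & Hd & Hd').
  set (q := m - Rmin m d / 2).
  assert (0 < Rmin m d) by (apply Rmin_glb_lt; lra).
  assert (Rmin m d <= m) by apply Rmin_l. assert (Rmin m d <= d) by apply Rmin_r.
  specialize (Hd' q). specialize (Hbelow q ltac:(unfold q; lra)).
  assert (Hq : Rabs (f q - f m) < a - f m) by (apply Hd'; unfold q; apply Rabs_def1; lra).
  apply Rabs_lt_between in Hq. lra. }
assert (Hfm' : a < f m).
{ apply Hind; [lra|]. intros r Hr.
  destruct (Rle_lt_or_eq_dec r m ltac:(lra)) as [Hrm | ->]; [apply Hbelow; lra | assumption]. }
destruct (Rle_lt_or_eq_dec m s Hms) as [Hms' | ->]; [|lra].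
destruct (Hcm (f m - a) ltac:(lra)) as (d & Hd & Hd').
assert (Hin : E (Rmin s (m + d / 2))).
{ split.
  - split; [apply Rmin_glb; lra | apply Rmin_l].
  - intros q Hq. assert (H := Rmin_r s (m + d / 2)).
    destruct (Rlt_le_dec q m) as [Hqm | Hqm]; [apply Hbelow; lra|].
    assert (Hq' := Hd' q ltac:(apply Rabs_def1; lra)).
    apply Rabs_lt_between in Hq'. lra. }
specialize (Hub _ Hin).
assert (m < Rmin s (m + d / 2)) by (apply Rmin_glb_lt; lra). lra.
Qed.

(** Keeps the argument of the real power positive and bounded, where it is Lipschitz. *)
Definition clamp (a b x : R) : R := Rmax a (Rmin b x).

Lemma clamp_between (a b x : R) : a <= b -> a <= clamp a b x <= b.
Proof.
intros H. unfold clamp. split; [apply Rmax_l|]. apply Rmax_lub; [lra | apply Rmin_l].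
Qed.

Lemma clamp_lipschitz (a b x y : R) : Rabs (clamp a b x - clamp a b y) <= Rabs (x - y).
Proof.
unfold clamp. apply Rle_trans with (Rabs (Rmin b x - Rmin b y)).
- generalize (Rmin b x) (Rmin b y). intros u v. unfold Rmax.
  destruct (Rle_dec a u), (Rle_dec a v); unfold Rabs; repeat destruct Rcase_abs; lra.
- unfold Rmin.
  destruct (Rle_dec b x), (Rle_dec b y); unfold Rabs; repeat destruct Rcase_abs; lra.
Qed.

Lemma fnl_clamp_lipschitz (p a b x y : R) : 1 < p -> 0 < a <= b ->
  Rabs (fnl p (clamp a b x) - fnl p (clamp a b y))
    <= (1 + p * Rpower b (p - 1)) * Rabs (x - y).
Proof.
intros Hp Hab.
assert (Hx := clamp_between a b x ltac:(lra)). assert (Hy := clamp_between a b y ltac:(lra)).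
assert (Hc := clamp_lipschitz a b x y).
set (cx := clamp a b x) in *. set (cy := clamp a b y) in *. unfold fnl, rpow.
replace (- cx + Rpower cx p - (- cy + Rpower cy p))
  with (- (cx - cy) + (Rpower cx p - Rpower cy p)) by ring.
eapply Rle_trans; [apply Rabs_triang|]. rewrite Rabs_Ropp.
assert (H := Rpower_lipschitz cx cy p b Hp ltac:(lra) ltac:(lra)).
assert (0 < p * Rpower b (p - 1)) by (apply Rmult_lt_0_compat; [lra | apply Rpower_pos]).
assert (p * Rpower b (p - 1) * Rabs (cx - cy) <= p * Rpower b (p - 1) * Rabs (x - y))
  by (apply Rmult_le_compat_l; lra).
lra.
Qed.

(** Clamping at [lo / 2] rather than [lo] leaves room for the bootstrap: as long as [v >= lo / 2],
    [v] solves the true equation, and the a priori bound raises this to [v >= lo]. *)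
Lemma rad_sol_exists (N : nat) (p S gam : R) :
  (3 <= N)%nat -> pS N < p -> 0 < S -> 1 < gam ->
  exists v v1 v2, rad_sol N p gam S v v1 v2.
Proof.
intros HN Hp HS Hgam.
destruct (emden_constants N p HN Hp) as (Hp1 & _).
destruct (rad_sol_lower_bound N p S HN Hp HS) as (lo & Hlo & Hlb).
assert (Hn : 3 <= INR N) by (apply (le_INR 3) in HN; simpl in HN; lra).
set (g := fun x => fnl p (clamp (lo / 2) gam x)).
assert (HgL : forall x y, Rabs (g x - g y) <= (1 + p * Rpower gam (p - 1)) * Rabs (x - y)).
{ intros x y. apply fnl_clamp_lipschitz; lra. }
destruct (radial_ivp (N - 1) g _ gam HgL) as (v & v1 & v2 & H0 & H1 & Hv).
assert (HNn : INR (N - 1) = INR N - 1) by (rewrite minus_INR by lia; reflexivity).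
rewrite HNn in Hv.
(* Potential of the clamped nonlinearity. Above [gam] its slope is the constant [fnl p gam > 0], so
   the dissipated energy forbids [v > gam] before [v] is known to solve the true equation. *)
set (G := (fun x => RInt g 0 x) : R -> R).
assert (HG : forall x, derivable_pt_lim G x (g x)).
{ intros x. apply is_derive_Reals.
  exact (RInt_0_derive g x (lipschitz_continuous g _ HgL)). }
assert (Hfg : 0 < fnl p gam).
{ unfold fnl, rpow. rewrite (Rpower_split gam p) by lra.
  assert (H := Rpower_gt_1 gam (p - 1) ltac:(lra) Hgam). nra. }
assert (Hup : forall s, 0 <= s -> v s <= gam).
{ intros s Hs. apply Rnot_lt_le. intros Hlt.
  destruct (MVT_cor2 G g gam (v s) Hlt (fun c _ => HG c)) as (c & Hc & Hc').
  assert (Hgc : g c = fnl p gam).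
  { unfold g, clamp. rewrite Rmin_left by lra. now rewrite Rmax_right by lra. }
  rewrite Hgc in Hc.
  assert (0 < fnl p gam * (v s - gam)) by (apply Rmult_lt_0_compat; lra).
  assert (HE : v1 s ^ 2 / 2 + G (v s) <= v1 0 ^ 2 / 2 + G (v 0)).
  { apply (deriv_nonpos_le (fun r => v1 r ^ 2 / 2 + G (v r))
      (fun r => v1 r * (v2 r + g (v r)))); [lra| |].
    - intros r _. destruct (Hv r) as (D1 & D2 & _).
      assert (DG := HG (v r)). apply is_derive_Reals in D1, D2, DG. apply is_derive_Reals.
      auto_derive; [repeat split; eexists; eassumption|]. rewrite_derives. field.
    - intros r Hr. destruct (Hv r) as (_ & _ & E). specialize (E ltac:(lra)).
      replace (v2 r + g (v r)) with (- ((INR N - 1) / r * v1 r)) by lra.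
      replace (v1 r * - ((INR N - 1) / r * v1 r)) with (- ((INR N - 1) / r * v1 r ^ 2)) by ring.
      assert (0 <= (INR N - 1) / r) by (apply Rdiv_le_0_compat; lra).
      assert (0 <= v1 r ^ 2) by apply pow2_ge_0. nra. }
  rewrite H0, H1 in HE. assert (0 <= v1 s ^ 2) by apply pow2_ge_0. lra. }
assert (Hsol : forall T, (forall r, 0 <= r <= T -> lo / 2 <= v r) -> rad_sol N p gam T v v1 v2).
{ intros T HT. split; [assumption|]. split; [assumption|]. intros s Hs.
  destruct (Hv s) as (D1 & D2 & E). specialize (HT s Hs). specialize (Hup s ltac:(lra)).
  repeat split; try assumption; [lra|].
  intros Hs0. rewrite <- (E Hs0). unfold g, clamp.
  rewrite Rmin_right by lra. rewrite Rmax_right by lra. reflexivity. }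
exists v, v1, v2. apply Hsol. intros r Hr. left.
apply (continuous_induction_gt v (lo / 2) S); [|lra| |exact Hr].
- intros x _. apply derivable_continuous_pt. exists (v1 x). apply Hv.
- intros s Hs Hrs. specialize (Hsol s Hrs).
  assert (lo <= v s); [|lra].
  apply (Hlb gam s v v1 v2); [lra | lra | assumption | lra].
Qed.

(** * Return from logarithmic time to the radius *)

Lemma exp_mul_ln_div (m s : R) : 0 < m -> 0 < s -> exp (m * (ln s / m)) = s.
Proof.
intros Hm Hs. replace (m * (ln s / m)) with (ln s) by (field; lra). now apply exp_ln.
Qed.

Lemma EF_ustar (N : nat) (p : R) (y : R -> R) (t : R) : (3 <= N)%nat -> pS N < p ->
  EF N p (ustar N p y) t = y t.
Proof.
intros HN Hp. destruct (emden_constants N p HN Hp) as (_ & _ & HA & Hm & _).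
unfold EF, ustar, Rpower at 1. rewrite ln_exp.
replace (mconst N p * t / mconst N p) with t by (field; lra).
replace (exp (mconst N p * theta p * t) *
   (Aconst N p * exp (- theta p * (mconst N p * t)) * y t) / Aconst N p)
  with (exp (mconst N p * theta p * t) * exp (- theta p * (mconst N p * t)) * y t) by (field; lra).
rewrite <- exp_plus.
replace (_ + _) with 0 by ring. rewrite exp_0. ring.
Qed.

(** The derivatives of [y] and of [ustar] are given independently; uniqueness of derivatives ties
    them together. *)
Lemma EF_ustar_derivs (N : nat) (p : R) (y y1 y2 us1 us2 : R -> R) :
  (3 <= N)%nat -> pS N < p ->
  (forall t, derivable_pt_lim y t (y1 t) /\ derivable_pt_lim y1 t (y2 t)) ->
  (forall s, 0 < s ->
     derivable_pt_lim (ustar N p y) s (us1 s) /\ derivable_pt_lim us1 s (us2 s)) ->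
  forall t, y1 t = EF1 N p (ustar N p y) us1 t /\ y2 t = EF2 N p (ustar N p y) us1 us2 t.
Proof.
intros HN Hp Hy Hus.
assert (H1 : forall t, y1 t = EF1 N p (ustar N p y) us1 t).
{ intros t. destruct (Hus (exp (mconst N p * t)) (exp_pos _)) as (D & _).
  apply EF_deriv in D. apply is_derive_Reals in D.
  apply (is_derive_ext _ y) in D; [|intros; now apply EF_ustar].
  destruct (Hy t) as (D' & _). apply is_derive_Reals in D'.
  rewrite <- (is_derive_unique _ _ _ D). symmetry. now apply is_derive_unique. }
intros t. split; [apply H1|].
destruct (Hus (exp (mconst N p * t)) (exp_pos _)) as (D & D2).
assert (D3 := EF1_deriv N p (ustar N p y) us1 us2 t D D2). apply is_derive_Reals in D3.
apply (is_derive_ext _ y1) in D3; [|intros; symmetry; apply H1].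
destruct (Hy t) as (_ & D'). apply is_derive_Reals in D'.
rewrite <- (is_derive_unique _ _ _ D3). symmetry. now apply is_derive_unique.
Qed.

(** The passage from [(u, s u', s^2 u'')] to the transform is triangular with constant coefficients,
    up to the factor [s^theta / A]. For [s >= a] this factor and the powers of [s] are bounded
    below, so inverting loses only a constant. *)
Lemma EF_close (N : nat) (p a eps : R) : (3 <= N)%nat -> pS N < p -> 0 < a -> 0 < eps ->
  exists del, 0 < del /\ forall (u u1 u2 v v1 v2 : R -> R) s, a <= s ->
  let t := ln s / mconst N p in
  Rabs (EF N p v t - EF N p u t) < del ->
  Rabs (EF1 N p v v1 t - EF1 N p u u1 t) < del ->
  Rabs (EF2 N p v v1 v2 t - EF2 N p u u1 u2 t) < del ->
  Rabs (v s - u s) < eps /\ Rabs (v1 s - u1 s) < eps /\ Rabs (v2 s - u2 s) < eps.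
Proof.
intros HN Hp Ha Heps.
destruct (emden_constants N p HN Hp) as (_ & Hth & HA & Hm & _).
set (m := mconst N p) in *. set (th := theta p) in *. set (A := Aconst N p) in *.
set (im := / m). assert (Him : 0 < im) by now apply Rinv_0_lt_compat.
assert (Hmm : im * m = 1) by (unfold im; field; lra).
set (ia := / a). assert (Hia : 0 < ia) by now apply Rinv_0_lt_compat.
set (c := exp (m * th * (ln a / m)) / A).
assert (Hc : 0 < c) by (apply Rdiv_lt_0_compat; [apply exp_pos | assumption]).
set (B1 := im + th). assert (HB1 : 0 < B1) by (unfold B1; lra).
set (B2 := im ^ 2 + th ^ 2 + (2 * th + 1) * B1).
assert (HB2 : 0 < B2).
{ assert (0 < im ^ 2) by nra. assert (0 < th ^ 2) by nra.
  assert (0 < (2 * th + 1) * B1) by (apply Rmult_lt_0_compat; lra). unfold B2; lra. }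
assert (HB1ia : 0 < B1 * ia) by now apply Rmult_lt_0_compat.
assert (HB2ia : 0 < B2 * ia ^ 2) by (apply Rmult_lt_0_compat; nra).
set (B := 1 + B1 * ia + B2 * ia ^ 2).
assert (HB : 1 < B) by (unfold B; lra).
set (X := eps / (2 * B)).
assert (HX : 0 < X) by (apply Rdiv_lt_0_compat; lra).
assert (HXB : X * B < eps) by (replace (X * B) with (eps / 2) by (unfold X; field; lra); lra).
exists (c * X). split; [now apply Rmult_lt_0_compat|].
intros u u1 u2 v v1 v2 s Hs t. unfold EF, EF1, EF2. fold m th A.
replace (exp (m * t)) with s by (symmetry; apply exp_mul_ln_div; lra).
set (e := exp (m * th * t)).
set (d0 := v s - u s). set (d1 := s * (v1 s - u1 s)). set (d2 := s ^ 2 * (v2 s - u2 s)).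
replace (e * v s / A - e * u s / A) with (e / A * d0) by (unfold d0; field; lra).
replace (m * e * (th * v s + s * v1 s) / A - m * e * (th * u s + s * u1 s) / A)
  with (e / A * (m * (th * d0 + d1))) by (unfold d0, d1; field; lra).
replace (m ^ 2 * e * (th ^ 2 * v s + (2 * th + 1) * (s * v1 s) + s ^ 2 * v2 s) / A -
   m ^ 2 * e * (th ^ 2 * u s + (2 * th + 1) * (s * u1 s) + s ^ 2 * u2 s) / A)
  with (e / A * (m ^ 2 * (th ^ 2 * d0 + (2 * th + 1) * d1 + d2)))
  by (unfold d0, d1, d2; field; lra).
assert (Hce : c <= e / A).
{ apply Rmult_le_compat_r; [left; now apply Rinv_0_lt_compat|].
  apply exp_le_mono. apply Rmult_le_compat_l; [left; now apply Rmult_lt_0_compat|].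
  apply Rmult_le_compat_r; [left; exact Him | apply ln_le; lra]. }
assert (Hscale : forall z, Rabs (e / A * z) < c * X -> Rabs z <= X).
{ intros z Hz. rewrite Rabs_mult, (Rabs_pos_eq (e / A)) in Hz by lra.
  assert (0 <= Rabs z) by apply Rabs_pos.
  apply Rmult_le_reg_l with c; [assumption|].
  assert (c * Rabs z <= e / A * Rabs z) by (apply Rmult_le_compat_r; lra). lra. }
intros H0 H1 H2.
apply Hscale in H0, H1, H2.
assert (K1 : Rabs d1 <= X * B1).
{ replace d1 with (im * (m * (th * d0 + d1)) + - (th * d0)).
  - eapply Rle_trans; [apply Rabs_triang|]. rewrite Rabs_Ropp, (Rabs_mult im), (Rabs_mult th d0).
    rewrite (Rabs_pos_eq im), (Rabs_pos_eq th) by lra. unfold B1.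
    assert (im * Rabs (m * (th * d0 + d1)) <= im * X) by (apply Rmult_le_compat_l; lra).
    assert (th * Rabs d0 <= th * X) by (apply Rmult_le_compat_l; lra). lra.
  - rewrite <- Rmult_assoc, Hmm. ring. }
assert (K2 : Rabs d2 <= X * B2).
{ replace d2 with (im ^ 2 * (m ^ 2 * (th ^ 2 * d0 + (2 * th + 1) * d1 + d2))
     + - (th ^ 2 * d0 + (2 * th + 1) * d1)).
  - eapply Rle_trans; [apply Rabs_triang|]. rewrite Rabs_Ropp.
    rewrite (Rabs_mult (im ^ 2)), (Rabs_pos_eq (im ^ 2)) by apply pow2_ge_0.
    assert (Rabs (th ^ 2 * d0 + (2 * th + 1) * d1) <= th ^ 2 * X + (2 * th + 1) * (X * B1)).
    { eapply Rle_trans; [apply Rabs_triang|].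
      rewrite (Rabs_mult (th ^ 2)), (Rabs_mult (2 * th + 1)).
      rewrite (Rabs_pos_eq (th ^ 2)) by apply pow2_ge_0.
      rewrite (Rabs_pos_eq (2 * th + 1)) by lra.
      apply Rplus_le_compat; apply Rmult_le_compat_l; try lra. apply pow2_ge_0. }
    assert (im ^ 2 * Rabs (m ^ 2 * (th ^ 2 * d0 + (2 * th + 1) * d1 + d2)) <= im ^ 2 * X)
      by (apply Rmult_le_compat_l; [apply pow2_ge_0 | lra]).
    unfold B2. lra.
  - rewrite <- Rmult_assoc, <- Rpow_mult_distr, Hmm. ring. }
assert (Hsi : 0 < / s <= ia).
{ split; [apply Rinv_0_lt_compat; lra | apply Rinv_le_contravar; lra]. }
assert (XB1 : 0 <= X * (B1 * ia)) by (apply Rmult_le_pos; lra).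
assert (XB2 : 0 <= X * (B2 * ia ^ 2)) by (apply Rmult_le_pos; lra).
assert (HXB' : X + X * (B1 * ia) + X * (B2 * ia ^ 2) < eps) by (unfold B in HXB; lra).
split; [lra|]. split.
- replace (v1 s - u1 s) with (d1 * / s) by (unfold d1; field; lra).
  rewrite Rabs_mult, (Rabs_pos_eq (/ s)) by lra.
  assert (Rabs d1 * / s <= X * B1 * ia)
    by (apply Rmult_le_compat; [apply Rabs_pos | lra | lra | lra]).
  lra.
- replace (v2 s - u2 s) with (d2 * (/ s) ^ 2) by (unfold d2; field; lra).
  rewrite Rabs_mult, (Rabs_pos_eq ((/ s) ^ 2)) by apply pow2_ge_0.
  assert (Rabs d2 * (/ s) ^ 2 <= X * B2 * ia ^ 2)
    by (apply Rmult_le_compat; [apply Rabs_pos | apply pow2_ge_0 | lra | apply pow_incr; lra]).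
  lra.
Qed.

(** Every compact subset of [(0, S]] lies in some [[a, S]]. Existence is asserted next to the
    estimate so that the quantification over solutions is not vacuous. *)
Theorem theorem5p1 (N : nat) (p S : R) (y y1 y2 us1 us2 : R -> R)
  (gam : nat -> R) :
  (3 <= N)%nat ->
  pS N < p ->
  0 < S ->
  ystar_sol N p y y1 y2 ->
  (forall s, 0 < s ->
     derivable_pt_lim (ustar N p y) s (us1 s) /\
     derivable_pt_lim us1 s (us2 s)) ->
  cv_infty gam ->
  forall a, 0 < a <= S ->
  forall eps, 0 < eps ->
  exists J : nat, forall j : nat, (J <= j)%nat ->
    (exists v v1 v2, rad_sol N p (gam j) S v v1 v2) /\
    (forall v v1 v2, rad_sol N p (gam j) S v v1 v2 ->
       forall s, a <= s <= S ->
         Rabs (v s - ustar N p y s) < eps /\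
         Rabs (v1 s - us1 s) < eps /\
         Rabs (v2 s - us2 s) < eps).
Proof.
intros HN Hp HS (Hy & Hlim) Hus Hgam a Ha eps Heps.
destruct (emden_constants N p HN Hp) as (Hp1 & Hth & HA & Hm & Hal & _).
set (T := ln S / mconst N p).
assert (Hln : forall b c, 0 < b -> b <= c -> ln b / mconst N p <= ln c / mconst N p).
{ intros b c Hb Hbc. apply Rmult_le_compat_r; [left; now apply Rinv_0_lt_compat|].
  apply ln_le; lra. }
destruct (EF_close N p a eps HN Hp ltac:(lra) Heps) as (del & Hdel & Hclose).
assert (Hys : emden_sol (mconst N p) (alpha N p) p T y y1 y2) by (intros t _; apply Hy).
assert (HM : 0 < emden_bound (mconst N p) p T).
{ unfold emden_bound. destruct (forcing_le _ T T Hm (Rle_refl _)) as [h0 _].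
  set (h := mconst N p ^ 2 * exp (2 * mconst N p * T)) in *.
  assert (H := Rpower_pos ((p + 1) / 2 * (1 + h)) (1 / (p - 1))).
  assert (0 < (p + 1) / 2 * (1 + h)) by (apply Rmult_lt_0_compat; lra).
  apply Rplus_lt_0_compat; [lra|]. apply Rmult_lt_0_compat; lra. }
destruct (emden_convergence _ _ p T _ (energy_gap N p) y y1 y2 Hm Hal Hp1 HM
  (energy_gap_pos N p HN Hp) Hys Hlim (ln a / mconst N p) del
  (Hln a S (proj1 Ha) (proj2 Ha)) Hdel) as (tau0 & Hconv).
(* Large [gamma] makes the core end before [tau0] in logarithmic time, and inside [[0, S]], where
   the energy gap is available. *)
destruct (core_radius_small p (Rmin S (exp (mconst N p * tau0))) Hp1) as (G & HG & Hcore).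
{ apply Rmin_glb_lt; [assumption | apply exp_pos]. }
destruct (Hgam (G + 1)) as (J & HJ). exists J. intros j Hj.
specialize (HJ j Hj).
split; [apply rad_sol_exists; try assumption; lra|].
intros v v1 v2 Hr s Hs.
assert (Hcr := Hcore (gam j) ltac:(lra)).
assert (Hcr1 := Rle_trans _ _ _ Hcr (Rmin_l _ _)).
assert (Hcr2 := Rle_trans _ _ _ Hcr (Rmin_r _ _)).
assert (Hcr0 := core_radius_pos p (gam j) Hp1).
assert (Hem := rad_sol_emden N p (gam j) S v v1 v2 HN Hp HS Hr). fold T in Hem.
assert (Hy' : forall t, derivable_pt_lim y t (y1 t) /\ derivable_pt_lim y1 t (y2 t))
  by (intros t; destruct (Hy t) as (D & D' & _); now split).
destruct (EF_ustar_derivs N p y y1 y2 us1 us2 HN Hp Hy' Hus (ln s / mconst N p)) as (E1 & E2).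
destruct (Hconv _ _ _ (ln (core_radius p (gam j)) / mconst N p) Hem) with
  (t := ln s / mconst N p) as (C0 & C1 & C2).
- replace tau0 with (ln (exp (mconst N p * tau0)) / mconst N p)
    by (rewrite ln_exp; field; lra).
  now apply Hln.
- intros t Ht. apply energy_nonpos_bounds; try assumption; [apply Hem, Ht|].
  apply (rad_sol_energy_nonpos N p (gam j) S v v1 v2); try assumption. lra.
- intros t Ht. apply (rad_sol_energy_gap N p (gam j) S v v1 v2); try assumption. lra.
- split; apply Hln; lra.
- apply (Hclose (ustar N p y) us1 us2 v v1 v2 s); [lra| | |].
  + now rewrite EF_ustar.
  + now rewrite <- E1.
  + now rewrite <- E2.
Qed.
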